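(* Let $B$ be a $d\times d$ expanding real matrix, and let $K$ and $K'$ be self-affine sets generated by two IFSs $\{B^{-1}(x+d_i)\}_{i=1}^m$ and $\{B^{-1}(x+d_i')\}_{i=1}^m$ with the same number $m$ of maps, both satisfying condition (H$_w$). Assume that the associated augmented trees (each with respect to a bounded closed invariant set of its IFS) are simple and that each of the incidence matrices is $(m,\mathbf b)$-rearrangeable, where $\mathbf b$ is the vector of cardinalities of the connected classes of the respective tree (in particular, the conclusion holds if the incidence matrices are primitive). Then $K$ and $K'$ are Lipschitz equivalent under the ultra-metric defined by $w$, and they are Lipschitz equivalent to a dust-like self-affine set.
   Context: $B$ is expanding: all eigenvalues have moduli $>1$. $q=|\det B|$. Self-affine IFS: $S_i(x)=B^{-1}(x+d_i)$, $d_i\in\mathbb R^d$, $i=1,\dots,m$; the self-affine set $K$ is the nonempty compact set with $K=\bigcup_iS_i(K)$; it is dust-like if $S_i(K)\cap S_j(K)=\emptyset$ for $i\ne j$. (The dust-like self-affine set in the conclusion is the attractor of such an IFS for some expanding matrix, equipped with the corresponding ultra-metric.) $\Sigma=\{1,\dots,m\}$, $X=\bigcup_{n\ge0}\Sigma^n$, $\Sigma^0=\{o\}$ (empty word); $S_{\mathbf u}=S_{i_1}\circ\cdots\circ S_{i_n}$, $K_{\mathbf u}=S_{\mathbf u}(K)$. Ultra-metric: choose a norm on $\mathbb R^d$ with $\|x\|\le\|Bx\|$ for all $x$, and let $U_t$ be the open ball of radius $t$ centred at $0$. For $0<\delta<1/2$ let $\varphi\ge0$ be a $C^\infty$ function supported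 in $U_\delta$ with $\varphi(x)=\varphi(-x)$ and $\int\varphi=1$. Let $V=BU_1\setminus U_1$, $h=\chi_V*\varphi$, and $w(x)=\sum_{n=-\infty}^\infty q^{-n/d}h(B^nx)$. Then (i) $w(x)=w(-x)$ and $w(x)=0$ iff $x=0$; (ii) $w(Bx)=q^{1/d}w(x)$; (iii) there is $\beta>1$ with $w(x+y)\le\beta\max\{w(x),w(y)\}$. The distance used is $w(x-y)$, and $\mathrm{dist}_w(E,F)=\inf\{w(x-y):x\in E,y\in F\}$. Lipschitz equivalence under $w$: a bijection $\sigma$ and $C>0$ with $C^{-1}w(x-y)\le w(\sigma(x)-\sigma(y))\le Cw(x-y)$ (with the respective $w$ on source and target). Condition (H$_w$): there is $c>0$ such that for all $n\ge1$, $\mathbf u,\mathbf v\in\Sigma^n$, $K_{\mathbf u}\cap K_{\mathbf v}=\emptyset$ implies $\mathrm{dist}_w(K_{\mathbf u},K_{\mathbf v})\ge cq^{-n/d}$. Augmented tree $(X,\mathcal E)$: $J$ is a fixed nonempty bounded closed set with $S_i(J)\subset J$ for all $i$; $J_{\mathbf u}=S_{\mathbf u}(J)$. $\mathcal E=\mathcal E_v\cup\mathcal E_h$; $\mathcal E_v$: (vertical) edges joining $\mathbf u$ and $\mathbf ui$; $\mathcal E_h$ (horizontal edges): pairs $(\mathbf u,\mathbf v)$, $\mathbf u\ne\mathbf v$ in the same level $\Sigma^n$, with $J_{\mathbf u}\cap J_{\mathbf v}\ne\emptyset$. Simple: a horizontal connected component is a maximal connected horizontal subgraph $T$ of some level $\Sigma^n$.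 $T\Sigma=\{\mathbf ui:\mathbf u\in T,i\in\Sigma\}$. $T\sim T'$ if there is a bijection $g:T\cup T\Sigma\to T'\cup T'\Sigma$ (as subgraphs of $X$) such that $g,g^{-1}$ preserve vertical and horizontal edges; $[T]$ is called a connected class. $X$ is simple if there are finitely many connected classes $\mathscr T_1,\dots,\mathscr T_\kappa$. Incidence matrix: $A=[a_{ij}]_{\kappa\times\kappa}$, where, for any component $T$ with $[T]=\mathscr T_i$, $a_{ij}$ is the number of horizontal connected components $Z$ of $T\Sigma$ with $[Z]=\mathscr T_j$ (this number being independent of the choice of $T$ in the class). $\mathbf b=[b_1,\dots,b_\kappa]^t$ with $b_i=\#T$ for $[T]=\mathscr T_i$. $A$ is primitive if $A^n>0$ entrywise for some $n>0$. Rearrangeable: a row vector $\mathbf a\in\mathbb Z_{\ge0}^\kappa$ is $(m,\mathbf b)$-rearrangeable if there are an integer $p>0$ and a nonnegative integral $p\times\kappa$ matrix $C$ with $\mathbf a=[1,\dots,1]C$ and $C\mathbf b=[m,\dots,m]^t$. A matrix is $(m,\mathbf b)$-rearrangeable if each of its rows is. *)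

(* Defs.v *)
From HB Require Import structures.
From Stdlib Require Export Relation_Operators.
From mathcomp Require Export all_boot all_order all_algebra.
From mathcomp Require Export complex.
From mathcomp Require Export all_classical all_reals all_analysis.

Set Implicit Arguments.
Unset Strict Implicit.
Unset Printing Implicit Defensive.

Import Order.TTheory GRing.Theory Num.Theory.
Import numFieldNormedType.Exports.

Local Open Scope classical_set_scope.
Local Open Scope card_scope.
Local Open Scope ring_scope.

(* R^d is the space of column vectors ['cV[R]_d.+1]: the variable [d] of this
   file is the dimension minus one, so that matrices form a unit ring and
   [B ^ k] makes sense for [k : int]. *)

Section LebesgueRn.
Context {R : realType}.

(* Integral over R^n with respect to Lebesgue measure, as the iterated
   integral over the coordinates; by Tonelli's theorem it is the Lebesgue
   integral for nonnegative Borel functions, the only ones used below. *)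
Fixpoint integral_Rn (n : nat) : ('cV[R]_n -> \bar R) -> \bar R :=
  match n return ('cV[R]_n -> \bar R) -> \bar R with
  | 0%N => fun f => f 0
  | n'.+1 => fun f =>
      (\int[@lebesgue_measure R]_t
         integral_Rn (fun y : 'cV[R]_n' => f (col_mx (t%:M : 'cV[R]_1) y)))%E
  end.

Definition convolution n (f g : 'cV[R]_n -> R) (x : 'cV[R]_n) : \bar R :=
  integral_Rn (fun y => (f (x - y) * g y)%:E).

Definition partial n (i : 'I_n.+1) (f : 'cV[R]_n.+1 -> R) : 'cV[R]_n.+1 -> R :=
  fun x => 'D_(delta_mx i 0) f x.

Definition smooth n (f : 'cV[R]_n.+1 -> R) : Prop :=
  forall s : seq 'I_n.+1,
    let g := foldr (@partial n) f s in
    continuous g /\ forall i x, derivable g x (delta_mx i 0).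

End LebesgueRn.

Section Ultrametric.
Context {R : realType} {d : nat}.
Local Notation V := 'cV[R]_d.+1.
Implicit Types (B : 'M[R]_d.+1) (N phi : V -> R) (w : V -> R).

Definition expanding B : Prop :=
  forall z : R[i], eigenvalue (map_mx (real_complex R) B) z -> 1 < `|z|.

(* q^(-k/d), where q = |det B| and d is the dimension *)
Definition scale B (k : int) : R :=
  `|\det B| `^ (- (k%:~R / d.+1%:R)).

Definition is_norm N : Prop :=
  [/\ forall x y, N (x + y) <= N x + N y,
      forall (a : R) x, N (a *: x) = `|a| * N x
    & forall x, N x = 0 -> x = 0].

Definition nball N (t : R) : set V := [set x | N x < t].

Definition mollifier N (delta : R) phi : Prop :=
  [/\ smooth phi,
      forall x, 0 <= phi x,
      closure [set x | phi x != 0] `<=` nball N delta,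
      forall x, phi x = phi (- x)
    & integral_Rn (fun x => (phi x)%:E) = 1%E].

Definition annulus B N : set V := (mulmx B @` nball N 1) `\` nball N 1.

(* The bi-infinite series has nonnegative terms, only finitely many of them
   nonzero, so that [fine] discards nothing. *)
Definition wseries B N phi (x : V) : R :=
  fine (\esum_(k in [set: int])
    ((scale B k)%:E * convolution \1_(annulus B N) phi ((B ^ k) *m x)))%E.

Definition ultrametric B w : Prop :=
  exists N (delta : R) phi,
    [/\ is_norm N,
        forall x, N x <= N (B *m x),
        0 < delta < 2^-1,
        mollifier N delta phi
      & w = wseries B N phi].

Definition wdist w (E F : set V) : R := inf [set w (x - y) | x in E & y in F].

Definition lipschitz_equiv w (K : set V) w' (K' : set V) : Prop :=
  exists (sigma : V -> V) (C : R),
    [/\ set_bij K K' sigma, 0 < C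
      & forall x y, K x -> K y ->
          C^-1 * w (x - y) <= w' (sigma x - sigma y) <= C * w (x - y)].

End Ultrametric.

Section IFS.
Context {R : realType} {d m : nat}.
Local Notation V := 'cV[R]_d.+1.
Local Notation word := (seq 'I_m).
Implicit Types (B : 'M[R]_d.+1) (D : 'I_m -> V) (w : V -> R) (K J : set V).

Definition ifs B D (i : 'I_m) (x : V) : V := invmx B *m (x + D i).

Definition ifs_word B D (u : word) (x : V) : V := foldr (ifs B D) x u.

Definition self_affine_set B D K : Prop :=
  [/\ K !=set0, compact K & K = \bigcup_i (ifs B D i @` K)].

Definition dust_like B D K : Prop :=
  forall i j, i <> j -> (ifs B D i @` K) `&` (ifs B D j @` K) = set0.

Definition condition_Hw B D w K : Prop :=
  exists2 c : R, 0 < c & forall (n : nat) (u v : word),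
    (1 <= n)%N -> size u = n -> size v = n ->
    (ifs_word B D u @` K) `&` (ifs_word B D v @` K) = set0 ->
    c * scale B n <= wdist w (ifs_word B D u @` K) (ifs_word B D v @` K).

Definition invariant_set B D J : Prop :=
  [/\ J !=set0, bounded_set J, closed J & forall i, ifs B D i @` J `<=` J].

Definition vedge (u v : word) : Prop :=
  exists i, v = rcons u i \/ u = rcons v i.

Definition hedge B D J (u v : word) : Prop :=
  [/\ u <> v, size u = size v
    & (ifs_word B D u @` J) `&` (ifs_word B D v @` J) !=set0].

Definition hcomponent B D J (T : set word) : Prop :=
  exists u, T = [set v | clos_refl_trans _ (hedge B D J) u v].

Definition offspring (T : set word) : set word :=
  [set v | exists u i, T u /\ v = rcons u i].

Definition class_equiv B D J (T T' : set word) : Prop :=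
  exists g : word -> word,
    set_bij (T `|` offspring T) (T' `|` offspring T') g /\
    forall u v, (T `|` offspring T) u -> (T `|` offspring T) v ->
      (vedge u v <-> vedge (g u) (g v)) /\
      (hedge B D J u v <-> hedge B D J (g u) (g v)).

(* [cls T] is the index of the class [T]; only the values of [cls] on
   components matter. The tree is simple iff such a [cls] exists for some
   [kappa]. *)
Definition class_enumeration B D J kappa (cls : set word -> 'I_kappa) : Prop :=
  (forall T T', hcomponent B D J T -> hcomponent B D J T' ->
     (cls T = cls T' <-> class_equiv B D J T T')) /\
  (forall i, exists2 T, hcomponent B D J T & cls T = i).

(* Since J_{ui} is contained in J_u, the components of the subgraph [offspring T] are
   the components of the tree contained in [offspring T]. *)
Definition incidence_matrix B D J kappa (cls : set word -> 'I_kappa)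
    (A : 'M[nat]_kappa) : Prop :=
  forall T j, hcomponent B D J T ->
    [set Z | [/\ hcomponent B D J Z, Z `<=` offspring T & cls Z = j]]
      #= `I_(A (cls T) j).

Definition class_sizes B D J kappa (cls : set word -> 'I_kappa)
    (b : 'cV[nat]_kappa) : Prop :=
  forall T, hcomponent B D J T -> T #= `I_(b (cls T) ord0).

End IFS.

Definition primitive kappa (A : 'M[nat]_kappa) : Prop :=
  exists2 n : nat, (0 < n)%N & forall i j, (0 < (A ^+ n) i j)%N.

Definition row_rearrangeable (m kappa : nat) (b : 'cV[nat]_kappa)
    (a : 'rV[nat]_kappa) : Prop :=
  exists (p : nat) (C : 'M[nat]_(p, kappa)),
    [/\ (0 < p)%N, a = const_mx 1%N *m C & C *m b = const_mx m].

Definition rearrangeable (m kappa : nat) (b : 'cV[nat]_kappa)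
    (A : 'M[nat]_kappa) : Prop :=
  forall i, row_rearrangeable m b (row i A).

(* Main.v *)
Require Import Defs.
From mathcomp Require Import perm measurable_realfun.
From mathcomp Require Import ring lra zify.

(** Idea of the proof. Both sets turn out to be bilipschitz to one model: the
    space of all sequences of [m] letters, where two sequences that part at
    time [n] are at distance [scale B n].

    Coding a set. Words of length [n] that lie in one horizontal component give
    pieces of [K] whose union, once rescaled by [B ^ n], has bounded diameter,
    because components have boundedly many words and each horizontal edge moves
    by a bounded amount after rescaling ([conn_gap]). Words in different
    components give pieces at distance at least [c * scale B n], by condition
    (H_w). So up to constants the distance of two points is read off from the
    last level at which they share a component. The components form a tree, but
    not the [m]-ary one. Either regularity hypothesis makes it possible to deal
    out the components [s] levels below a component with [p] words among these
    [p] words so that each receives [m ^ s] words in total: in the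
    rearrangeable case this is the definition, and in the primitive case a
    greedy packing works, because there are many components with a single word
    to fill the gaps ([rearrangeable_dealt], [many_singletons_dealt]). This
    defines a new parent map on words, all of whose fibres have [m ^ s]
    elements and which sends a whole component to one word ([regrouping]). The
    addresses of the points of [K] with respect to this new tree are all the
    sequences of letters, and two points separate in it at the same level, up
    to a bounded shift, as their components do ([ends_coding], [ifs_coded]).
    Two coded sets are bilipschitz to each other, by matching addresses
    ([coded_lipschitz]).

    The dust-like set. A dust-like set with [m] maps and a dilation of
    determinant [q = |det B|] exists as soon as [m < q]: a Cantor set on the
    first coordinate axis, for a diagonal matrix that dilates this axis by more
    than [m] and the other axes by more than 1. The inequality [m < q] follows
    from the coding ([coded_lt_det]): on regularly spaced levels the pieces of
    the set are well separated, and next to each of them there is room for a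
    small cube that avoids the neighbourhoods of the set at the finer levels.
    These cubes are disjoint; if [m >= q], each level would contribute a fixed
    amount of volume to a bounded region. Volume is measured by counting
    lattice points, which scales with the determinant up to a constant
    ([lattice_points_parallelepiped]).

    The function [w]. The properties that matter are the scaling under [B],
    boundedness on bounded sets ([gauge]) and, for the Cantor set, a lower
    bound on a fundamental domain of the axis. The last one uses that the
    mollifier is even: half of its mass lies on either side of a hyperplane
    ([half_mass]). *)

Set Implicit Arguments.
Unset Strict Implicit.
Unset Printing Implicit Defensive.

Import Order.TTheory GRing.Theory Num.Theory.
Import numFieldNormedType.Exports.
Local Open Scope classical_set_scope.
Local Open Scope card_scope.
Local Open Scope ring_scope.

(** * Powers of the inverse of an expanding matrix *)

Section Decay.
Context {R : realType}.

Definition decays (a : nat -> R) : Prop :=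
  exists (c r : R), [/\ 0 <= c, 0 < r < 1 & forall n, a n <= c * r ^+ n].

Lemma decays_rec (a b : nat -> R) (mu : R) : 0 <= mu < 1 -> 0 <= a 0%N ->
  (forall n, a n.+1 <= mu * (a n + b n.+1)) -> decays b -> decays a.
Proof.
move=> /andP[mu0 mu1] a0 rec [c [r [c0 /andP[r0 r1] bE]]].
pose r' := Num.max r ((mu + 1) / 2).
have r'0 : 0 < r' by rewrite lt_max r0.
have r'1 : r' < 1 by rewrite gt_max r1 /=; lra.
have mur' : mu < r' by rewrite lt_max; apply/orP; right; lra.
have rr' : r <= r' by rewrite le_max lexx.
have dr : 0 < r' - mu by rewrite subr_gt0.
pose c' := a 0%N + mu * c / (r' - mu).
have c'0 : 0 <= mu * c / (r' - mu) by rewrite divr_ge0 ?mulr_ge0// ltW.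
exists c', r'; split; rewrite ?addr_ge0 ?r'0//.
elim=> [|n IH]; first by rewrite expr0 mulr1 lerDl.
apply: (le_trans (rec n)).
have bn : b n.+1 <= c * r' ^+ n.
  apply: (le_trans (bE _)); rewrite ler_wpM2l//.
  rewrite exprS (le_trans (y := r ^+ n))//.
    by rewrite ler_piMl ?exprn_ge0// ltW.
  by rewrite lerXn2r// nnegrE ltW.
have rn : 0 <= r' ^+ n by rewrite exprn_ge0// ltW.
apply: (le_trans (y := mu * ((c' + c) * r' ^+ n))).
  by rewrite ler_wpM2l// mulrDl lerD.
rewrite exprS mulrA mulrA ler_wpM2r//.
have e : mu * c = (r' - mu) * (mu * c / (r' - mu)).
  by rewrite mulrCA divff ?mulr1// gt_eqF.
rewrite mulrDr e /c'; set t := mu * c / _; set x := a 0%N.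
have := mulr_ge0 a0 (ltW dr); rewrite -/x; lra.
Qed.

End Decay.

Section ComplexMatrix.
Context {R : realType} {d : nat}.
Import ComplexField.Normc.
Local Notation C := R[i].
Implicit Types (M X Y : 'M[C]_d.+1).

Definition cnorm X : R := \sum_i \sum_j normc (X i j).

Lemma normc_ge0 (z : C) : 0 <= normc z.
Proof. by case: z => x y /=; exact: sqrtr_ge0. Qed.

Lemma cnorm_ge0 X : 0 <= cnorm X.
Proof. by apply: sumr_ge0 => i _; apply: sumr_ge0 => j _; exact: normc_ge0. Qed.

Lemma cnormB X Y : cnorm (X - Y) <= cnorm X + cnorm Y.
Proof.
rewrite -big_split /=; apply: ler_sum => i _.
rewrite -big_split /=; apply: ler_sum => j _.
by rewrite !mxE (le_trans (le_normcD _ _))// normcN.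
Qed.

Lemma cnormZ (a : C) X : cnorm (a *: X) = normc a * cnorm X.
Proof.
rewrite mulr_sumr; apply: eq_bigr => i _; rewrite mulr_sumr.
by apply: eq_bigr => j _; rewrite mxE normcM.
Qed.

Lemma entry_le_cnorm X i j : normc (X i j) <= cnorm X.
Proof.
rewrite /cnorm (bigD1 i)//= (bigD1 j)//= -addrA lerDl addr_ge0//.
  by apply: sumr_ge0 => k _; exact: normc_ge0.
by apply: sumr_ge0 => k _; apply: sumr_ge0 => l _; exact: normc_ge0.
Qed.

(** One linear factor of an annihilating polynomial is removed at a time: with
    [Y = (M - l) X] the powers satisfy
    [M^-(n+1) X = l^-1 (M^-n X - M^-(n+1) Y)]. *)
Lemma inv_powers_decay M (s : seq C) X : M \is a GRing.unit ->
  (forall l, l \in s -> 1 < normc l) ->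
  (\prod_(l <- s) (M - l%:M)) * X = 0 ->
  decays (fun n => cnorm (M ^- n * X)).
Proof.
move=> Mu; elim: s X => [|l s IH] X sl.
  rewrite big_nil mul1r => ->; exists 0, 2^-1; split => //.
    by rewrite invr_gt0 ltr0n invf_lt1 ?ltr1n.
  move=> n; rewrite mulr0 mul0r /cnorm big1// => i _; rewrite big1// => j _.
  by rewrite mxE normc0.
have comm : GRing.comm (M - l%:M) (\prod_(k <- s) (M - k%:M)).
  apply: big_rec => [|k y _ cy]; first exact: commr1.
  apply: commrM => //; apply: commrB; last exact: comm_mx_scalar.
  by apply/commr_sym/commrB; [exact: commr_refl | exact: comm_mx_scalar].
rewrite big_cons comm -mulrA => Y0.
have l1 : 1 < normc l by apply: sl; rewrite mem_head.
have l0 : l != 0 by apply: contraTneq l1 => ->; rewrite normc0 ltr10.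
have decY := IH _ (fun k ks => sl k (mem_behead (s := _ :: _) ks)) Y0.
apply: (decays_rec (mu := (normc l)^-1)) decY.
- by rewrite invr_ge0 normc_ge0 invf_lt1// (lt_trans ltr01).
- exact: cnorm_ge0.
move=> n; have -> : M ^- n.+1 * X =
    l^-1 *: (M ^- n * X - M ^- n.+1 * ((M - l%:M) * X)).
  have MX : M ^- n.+1 * (M * X) = M ^- n * X.
    by rewrite mulrA exprS invrM ?unitrX// divrK.
  rewrite mulrBl mulrBr MX opprB addrCA subrr addr0.
  by rewrite [l%:M * X]mul_scalar_mx -scalerAr scalerA mulVf// scale1r.
by rewrite cnormZ normcV ler_wpM2l ?invr_ge0 ?normc_ge0// cnormB.
Qed.

End ComplexMatrix.

Section Expanding.
Context {R : realType} {d : nat}.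
Import ComplexField.Normc.
Local Notation C := R[i].
Local Notation toC := (map_mx (real_complex R)).
Implicit Types (B : 'M[R]_d.+1).

Lemma char_poly_roots_expanding B : expanding B ->
  exists2 s : seq C, char_poly (toC B) = \prod_(l <- s) ('X - l%:P)
    & forall l, l \in s -> 1 < normc l.
Proof.
move=> eB; have [s sE] := closed_field_poly_normal (char_poly (toC B)).
move: sE; rewrite (monicP (char_poly_monic _)) scale1r => sE.
exists s; first exact: sE.
move=> l ls; have : root (char_poly (toC B)) l.
  by rewrite sE root_prod_XsubC.
by rewrite -eigenvalue_root_char -ltcR; exact: eB.
Qed.

Lemma det_expanding B : expanding B -> 1 < `|\det B|.
Proof.
move=> eB; have [s sE s1] := char_poly_roots_expanding eB.
have e1 : `|\det B| = \prod_(l <- s) normc l.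
  have -> : `|\det B| = normc ((-1) ^+ d.+1 * \det (toC B)).
    rewrite normcM det_map_mx /= expr0n /= addr0 sqrtr_sqr.
    suff -> : normc ((-1) ^+ d.+1 : C) = 1 by rewrite mul1r.
    by elim: d.+1 => [|n IH]; rewrite ?expr0 ?normc1// exprS normcM IH normcN normc1 mulr1.
  rewrite -char_poly_det sE -horner_coef0 horner_prod.
  rewrite (big_morph (@normc R) (@normcM R) (normc1 R)).
  by apply: eq_bigr => l _; rewrite hornerXsubC sub0r normcN.
have : size s = d.+1.
  have := size_char_poly (toC B).
  by rewrite sE size_prod_XsubC => -[].
rewrite e1; case: s {sE e1} s1 => // l s s1 _.
have l1 : 1 < normc l by apply: s1; rewrite mem_head.
rewrite big_cons (lt_le_trans l1)// ler_peMr ?(ltW (lt_trans ltr01 l1))//.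
rewrite big_seq; elim/big_rec: _ => // k x ks x1.
by rewrite mulr_ege1// ltW// s1// inE ks orbT.
Qed.

Lemma expanding_unit B : expanding B -> B \is a GRing.unit.
Proof.
move=> /det_expanding B1; rewrite unitmxE unitfE -normr_gt0.
exact: lt_trans B1.
Qed.

(** By the Cayley-Hamilton theorem the linear factors of the characteristic
    polynomial of [B] annihilate the identity matrix. *)
Lemma inv_powers_entries B : expanding B ->
  exists (c r : R), [/\ 0 <= c, 0 < r < 1 &
    forall n i j, `|(B ^- n) i j| <= c * r ^+ n].
Proof.
move=> eB; have [s sE s1] := char_poly_roots_expanding eB.
have Mu : toC B \is a GRing.unit.
  by rewrite -[_ \is a _]/(_ \in unitmx) map_unitmx; exact: expanding_unit.
have prod0 : \prod_(l <- s) (toC B - l%:M) * 1 = 0.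
  rewrite mulr1 -[RHS](Cayley_Hamilton (toC B)) sE rmorph_prod /=.
  by apply: eq_bigr => l _; rewrite rmorphB /= horner_mx_X horner_mx_C.
have [c [r [c0 r01 cr]]] := inv_powers_decay Mu s1 prod0.
exists c, r; split => // n i j; apply: le_trans (cr n).
have -> : `|(B ^- n) i j| = normc ((toC B ^- n * 1) i j).
  have -> : toC B ^- n = toC (B ^- n).
    by rewrite -rmorphXn; exact/esym/map_invmx.
  by rewrite mulr1 mxE /= expr0n /= addr0 sqrtr_sqr.
exact: entry_le_cnorm.
Qed.

End Expanding.

Section SupNorm.
Context {R : realType}.

Lemma entry_le_norm n p (x : 'M[R]_(n, p)) i j : `|x i j| <= `|x|.
Proof.
rewrite [leRHS]/Num.norm /= mx_normrE.
by apply/bigmax_geP; right; exists (i, j).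
Qed.

Lemma norm_le_entries n p (x : 'M[R]_(n, p)) (c : R) : 0 <= c ->
  (forall i j, `|x i j| <= c) -> `|x| <= c.
Proof.
move=> c0 xc; rewrite [leLHS]/Num.norm /= mx_normrE.
by apply/bigmax_leP; split => // -[i j] _; exact: xc.
Qed.

Lemma norm_lt_entries n p (x : 'M[R]_(n, p)) (c : R) : 0 < c ->
  (forall i j, `|x i j| < c) -> `|x| < c.
Proof.
move=> c0 xc; rewrite [ltLHS]/Num.norm /= mx_normrE.
by apply/bigmax_ltP; split => // -[i j] _; exact: xc.
Qed.

Lemma norm_mulmx_le n p (M : 'M[R]_(n, p)) (x : 'cV[R]_p) (c : R) : 0 <= c ->
  (forall i j, `|M i j| <= c) -> `|M *m x| <= p%:R * c * `|x|.
Proof.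
move=> c0 Mc; apply: norm_le_entries => [|i j]; first by rewrite !mulr_ge0.
rewrite mxE (le_trans (ler_norm_sum _ _ _))// -mulrA -[p in p%:R]card_ord.
rewrite mulr_natl -sumr_const ler_sum// => k _.
by rewrite normrM ler_pM// entry_le_norm.
Qed.

Lemma norm_mulmx n p (M : 'M[R]_(n, p)) (x : 'cV[R]_p) :
  `|M *m x| <= p%:R * `|M| * `|x|.
Proof. by apply: norm_mulmx_le => // i j; exact: entry_le_norm. Qed.

Lemma lipschitz_cst_continuous (V W : normedModType R) (f : V -> W) (c : R) :
  0 < c -> (forall x y, `|f x - f y| <= c * `|x - y|) -> continuous f.
Proof.
move=> c0 fc v; apply/cvgrPdist_lt => e e0; near=> u.
apply: (le_lt_trans (fc _ _)); rewrite mulrC -ltr_pdivlMr//; near: u.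
by apply/nbhs_ballP; exists (e / c); [exact: divr_gt0|move=> u; rewrite -ball_normE].
Unshelve. all: by end_near. Qed.

Lemma affine_continuous d (M : 'M[R]_d.+1) (a : 'cV[R]_d.+1) :
  continuous (fun x : 'cV[R]_d.+1 => M *m (x + a)).
Proof.
apply: (@lipschitz_cst_continuous _ _ _ (d.+1%:R * `|M| + 1)) => [|x y].
  by rewrite ltr_wpDl// mulr_ge0.
rewrite -mulmxBr opprD addrACA subrr addr0 (le_trans (norm_mulmx _ _))//.
by rewrite ler_wpM2r// lerDl.
Qed.

Lemma expanding_contraction d (B : 'M[R]_d.+1) : expanding B ->
  exists (c r : R), [/\ 0 < c, 0 < r < 1 &
    forall n (x : 'cV[R]_d.+1), `|B ^- n *m x| <= c * r ^+ n * `|x|].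
Proof.
move=> /inv_powers_entries[c [r [c0 /andP[r0 r1] cr]]].
exists (d.+1%:R * (c + 1)), r; split; rewrite ?r0//.
  by rewrite mulr_gt0// ltr_wpDl.
move=> n x; rewrite -[_ * _ * r ^+ n]mulrA; apply: norm_mulmx_le.
  by rewrite mulr_ge0 ?exprn_ge0 ?ltW// ltr_wpDl.
move=> i j; apply: (le_trans (cr n i j)).
by rewrite ler_wpM2r ?exprn_ge0 ?lerDl ?ltW.
Qed.

Lemma is_norm_le_sup d (N : 'cV[R]_d.+1 -> R) : is_norm N ->
  exists2 c : R, 0 < c & forall x, N x <= c * `|x|.
Proof.
move=> [ND NZ _].
have N0 : N 0 = 0 by rewrite -(scale0r 0) NZ normr0 mul0r.
have NN x : N (- x) = N x by rewrite -scaleN1r NZ normrN1 mul1r.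
have Nge0 x : 0 <= N x.
  have := ND x (- x); rewrite subrr N0 NN; lra.
exists (1 + \sum_i N (delta_mx i 0)).
  by rewrite ltr_pwDl// sumr_ge0.
move=> x; rewrite [in N _](matrix_sum_delta x).
under eq_bigr do rewrite big_ord1.
have : N (\sum_i x i ord0 *: delta_mx i ord0) <= \sum_i N (x i ord0 *: delta_mx i ord0).
  elim/big_rec2: _ => [|i y z _ yz]; first by rewrite N0.
  by apply: le_trans (ND _ _) _; rewrite lerD2l.
move/le_trans; apply; rewrite mulrDl mul1r mulr_suml ler_wpDl//.
by apply: ler_sum => i _; rewrite NZ mulrC ler_wpM2l// entry_le_norm.
Qed.

(** The minimum of [N] on the compact unit sphere is positive. *)
Lemma sup_le_is_norm d (N : 'cV[R]_d.+1 -> R) : is_norm N ->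
  exists2 c : R, 0 < c & forall x, `|x| <= c * N x.
Proof.
move=> nN; have [c c0 Nc] := is_norm_le_sup nN.
move: nN => [ND NZ N0].
have NZ0 : N 0 = 0 by rewrite -(scale0r 0) NZ normr0 mul0r.
have NN x : N (- x) = N x by rewrite -scaleN1r NZ normrN1 mul1r.
have Nge0 x : 0 <= N x.
  have := ND x (- x); rewrite subrr NZ0 NN; lra.
have normT n p (x : 'M[R]_(n, p)) : `|x^T| = `|x|.
  apply/eqP; rewrite eq_le; apply/andP; split;
    apply: norm_le_entries => // i j.
    by rewrite mxE entry_le_norm.
  by have := entry_le_norm x^T j i; rewrite mxE.
pose f (v : 'rV[R]_d.+1) := N v^T.
have fcont : continuous f.
  apply: (lipschitz_cst_continuous c0) => v u.
  have dN x y : N x - N y <= N (x - y).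
    by have := ND (x - y) y; rewrite subrK lerBlDr.
  rewrite -(normT _ _ (v - u)) linearB /= (le_trans _ (Nc _))//.
  by rewrite ler_norml lerNl opprB dN -NN opprB dN.
pose S := [set v : 'rV[R]_d.+1 | `|v| = 1].
have S0 : S !=set0.
  exists (const_mx 1); rewrite /S /=; apply/eqP; rewrite eq_le; apply/andP; split.
    by apply: norm_le_entries => // i j; rewrite mxE normr1.
  have := entry_le_norm (const_mx 1 : 'rV[R]_d.+1) ord0 ord0.
  by rewrite mxE normr1.
have cS : compact S.
  apply: bounded_closed_compact.
    by exists 1; split => // M M1 v; rewrite /S /= => ->; exact: ltW.
  rewrite (_ : S = (fun v => `|v|) @^-1` [set 1])//.
  apply: closed_comp; last exact: closed_eq.
  by move=> v _; apply: norm_continuous.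
have [v vS fv] := EVT_min_rV S0 cS (continuous_subspaceT fcont).
move: vS; rewrite inE /S /= => v1.
have fv0 : 0 < f v.
  rewrite lt_neqAle Nge0 andbT eq_sym; apply: contra_eq_neq v1 => /N0 e.
  by rewrite -[v]trmxK e trmx0 normr0 eq_sym oner_neq0.
exists (f v)^-1; first by rewrite invr_gt0.
move=> x; have [->|x0] := eqVneq x 0; first by rewrite NZ0 normr0 mulr0.
have nx : 0 < `|x| by rewrite normr_gt0.
rewrite mulrC ler_pdivlMr// mulrC -ler_pdivlMr// mulrC.
have -> : `|x|^-1 * N x = f (`|x|^-1 *: x^T).
  by rewrite /f linearZ /= trmxK NZ ger0_norm// invr_ge0.
apply: fv; rewrite inE /S /= normrZ normT ger0_norm ?invr_ge0// mulVf//.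
by rewrite gt_eqF.
Qed.

End SupNorm.

(** * Counting lattice points in linear images of the cube *)

Section Lattice.
Context {R : realType}.

(** The integers just below [x] already suffice. *)
Lemma integers_near (x L : R) : 1 <= L ->
  exists s : seq int, [/\ uniq s, forall z, z \in s -> `|z%:~R - x| < L
    & L / 2 <= (size s)%:R].
Proof.
move=> L1; have L0 : 0 <= L := le_trans ler01 L1.
have /andP[tL Lt] := truncn_itv L0.
exists [seq Num.floor x - k%:Z | k <- iota 0 (Num.truncn L)]; split.
- rewrite map_inj_uniq ?iota_uniq// => i j /addrI/oppr_inj.
  by case.
- move=> z /mapP[k]; rewrite mem_iota add0n => /andP[_ kL] ->.
  have := floor_itv x; rewrite intrD => /andP[fx xf].
  have kL' : (k.+1%:R : R) <= L by rewrite (le_trans _ tL)// ler_nat.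
  rewrite distrC rmorphB /= ger0_norm; last first.
    by rewrite opprB addrA subr_ge0 (le_trans fx)// lerDl.
  rewrite opprB addrA (lt_le_trans _ kL')// -natr1; move: xf.
  rewrite -!pmulrn; lra.
- rewrite size_map size_iota; move: Lt; rewrite -natr1.
  have : (1 : R) <= (Num.truncn L)%:R by rewrite ler1n truncn_gt0.
  lra.
Qed.

(** The pivot [a] is an entry of largest modulus in the first row, so that the
    column operations that clear this row shrink the unit cube by the factor
    [n + 1] only, whatever the matrix. *)
Lemma row_reduction n (A : 'M[R]_(1 + n)) : \det A != 0 ->
  exists (a : R) (c : 'cV[R]_n) (E : 'M[R]_n),
    [/\ a != 0, `|\det A| = `|a| * `|\det E| &
    forall (t : R) (v : 'cV[R]_n), `|t| < 1 -> (forall i, `|v i 0| < 1) ->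
      exists y : 'cV[R]_(1 + n), (forall i, `|y i 0| < 1) /\
        A *m y = n.+1%:R^-1 *: col_mx (a * t)%:M (t *: c + E *m v)].
Proof.
move=> A0; pose j := [arg max_(j > 0 : 'I_(1 + n)) `|A 0 j|]%O.
have jmax k : `|A 0 k| <= `|A 0 j|.
  by rewrite /j; case: arg_maxP => // i _; apply.
have a0 : A 0 j != 0.
  apply: contra_neq A0 => Aj; rewrite (expand_det_row _ 0) big1// => k _.
  have := jmax k; rewrite Aj normr0 normr_le0 => /eqP->.
  by rewrite mul0r.
pose A1 : 'M[R]_(1 + n) := xcol 0 j A.
pose a := A 0 j; pose r : 'rV[R]_n := a^-1 *: ursubmx A1.
pose c := dlsubmx A1; pose E := drsubmx A1 - c *m r.
have A1E : A1 = block_mx a%:M (a *: r) c (E + c *m r).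
  rewrite -[LHS]submxK /E /c subrK /r scalerA mulfV// scale1r.
  congr block_mx; rewrite [LHS]mx11_scalar; congr (_%:M).
  by rewrite !mxE lshift0 tpermL.
have r1 k : `|r 0 k| <= 1.
  rewrite !mxE normrM normfV mulrC ler_pdivrMr ?normr_gt0// mul1r.
  by rewrite lshift0 jmax.
exists a, c, E; split => //.
  have -> : `|\det A| = `|\det A1|.
    by rewrite /A1 xcolE det_mulmx det_perm normrM normr_sign mulr1.
  have -> : A1 = block_mx a%:M 0 c E *m block_mx 1%:M r 0 1%:M.
    rewrite mulmx_block !mulmx1 !mulmx0 ?mul0mx !addr0 ?add0r mul_scalar_mx.
    by rewrite A1E addrC.
  by rewrite det_mulmx det_lblock det_ublock !det1 !mulr1 det_scalar1 normrM.
move=> t v t1 v1; pose s : R := n.+1%:R^-1.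
have s0 : 0 < s by rewrite invr_gt0.
pose y1 : 'cV[R]_(1 + n) := s *: col_mx (t%:M - r *m v) v.
exists (tperm_mx 0 j *m y1); split; last first.
  have A1y (y0 : 'M[R]_1) (y' : 'cV[R]_n) : A1 *m col_mx y0 y' =
      col_mx (a%:M *m y0 + (a *: r) *m y') (c *m y0 + (E + c *m r) *m y').
    by rewrite A1E mul_block_col.
  rewrite /y1 mulmxA -xcolE -/A1 -scalemxAr A1y; congr (_ *: col_mx _ _).
    rewrite mulmxBr -scalemxAl mul_scalar_mx mul_scalar_mx subrK.
    by rewrite scale_scalar_mx.
  rewrite mulmxDl mulmxBr mulmxA [E *m v + _]addrC addrA subrK.
  by rewrite mul_mx_scalar.
have y1lt i : `|y1 i 0| < 1.
  rewrite mxE normrM gtr0_norm// mulrC ltr_pdivrMr// mul1r.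
  rewrite mxE; case: splitP => k _; last first.
    by rewrite (lt_le_trans (v1 _))// ler1n.
  rewrite !mxE ord1 eqxx mulr1n -natr1 (le_lt_trans (ler_normB _ _))//.
  rewrite addrC ler_ltD// (le_trans (ler_norm_sum _ _ _))//.
  rewrite -[n in n%:R]card_ord -[leRHS]mulr1 mulr_natl -sumr_const ler_sum// => l _.
  by rewrite normrM mulr_ile1// ltW.
move=> i; rewrite -xrowE mxE; exact: y1lt.
Qed.

Definition lattice_family n (E : 'cV[R]_n -> Prop) (s : seq 'cV[int]_n) : Prop :=
  uniq s /\ forall z, z \in s -> E (map_mx intr z).

(** The points are counted in the sections by the hyperplanes where the first
    coordinate is an integer: each section contains a translate of the image of
    a smaller cube under a matrix of size [n]. The constant [c] depends on the
    dimension only; the threshold [rho0], below which a section may miss the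
    lattice, depends on [A]. *)
Lemma lattice_points_parallelepiped n : exists2 c : R, 0 < c &
  forall A : 'M[R]_n, exists rho0 : R, forall rho, rho0 <= rho ->
  forall x : 'cV[R]_n, exists2 s : seq 'cV[int]_n,
    lattice_family (fun z => exists2 y : 'cV[R]_n,
      (forall i, `|y i 0| < 1) & z = x + rho *: (A *m y)) s
    & c * rho ^+ n * `|\det A| <= (size s)%:R.
Proof.
elim: n => [|n [c c0 IH]].
  exists 1 => // A; exists 0 => rho _ x; exists [:: 0].
    split=> // z _; exists 0 => [[]//|].
    by apply/matrixP => -[].
  by rewrite det_mx00 normr1 expr0 !mulr1.
pose s : R := n.+1%:R^-1; have s0 : 0 < s by rewrite invr_gt0.
exists (c * s ^+ n.+1 / 2); first by rewrite !mulr_gt0 ?exprn_gt0 ?invr_gt0.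
move=> A; have [A0|A0] := eqVneq (\det A) 0.
  by exists 0 => rho _ x; exists [::]; rewrite ?A0 ?normr0 ?mulr0//; split.
have [a [cc [E [a0 detA Ay]]]] := row_reduction (n := n) A0.
have [rho0 {}IH] := IH E.
have as0 : 0 < `|a| * s by rewrite mulr_gt0 ?normr_gt0.
exists (Num.max (Num.max 1 (rho0 / s)) (`|a| * s)^-1) => rho.
rewrite !ge_max => /andP[/andP[rho1 rhos] rhoa] x.
have rhogt0 : 0 < rho := lt_le_trans ltr01 rho1.
pose L := rho * (`|a| * s); have L1 : 1 <= L by rewrite -ler_pdivrMr// mul1r.
have [z0s [uz z0P szL]] := integers_near (x 0 0) L1.
pose t (z : int) := (z%:~R - x 0 0) / (rho * a * s).
pose x' : 'cV[R]_n := dsubmx (x : 'cV_(1 + n)).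
have rs : rho0 <= rho * s by rewrite -ler_pdivrMr.
pose S_sig z := cid2 (IH _ rs (x' + rho *: (s *: (t z *: cc)))).
pose S z := s2val (S_sig z).
pose F (z : int) (z' : 'cV[int]_n) : 'cV[int]_(1 + n) := col_mx z%:M z'.
exists [seq F z z' | z <- z0s, z' <- S z]; last first.
  rewrite size_allpairs_dep sumnE big_map natr_sum.
  apply: (@le_trans _ _ (\sum_(z <- z0s) (c * (rho * s) ^+ n * `|\det E|))).
    rewrite big_const_seq count_predT iter_addr_0 -[leRHS]mulr_natr.
    apply: (@le_trans _ _ (c * (rho * s) ^+ n * `|\det E| * (L / 2))).
      rewrite detA /L exprMn [s ^+ n.+1]exprS [rho ^+ n.+1]exprS le_eqVlt.
      apply/orP; left; apply/eqP; by field.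
    by rewrite ler_wpM2l// !mulr_ge0 ?exprn_ge0 ?mulr_ge0 // ltW.
  by apply: ler_sum => z _; exact: (s2valP' (S_sig z)).
split.
  apply: allpairs_uniq_dep => // [z _|]; first by have [] := s2valP (S_sig z).
  move=> [z1 z1'] [z2 z2'] _ _ /= F12.
  have [+ e'] := @eq_col_mx int 1 n 1 z1%:M z1' z2%:M z2' F12.
  by move=> /matrixP /(_ 0 0); rewrite !mxE !mulr1n e' => ->.
move=> z /allpairsPdep[z1 [z2 [z1s z2S ->]]].
have [_ SP] := s2valP (S_sig z1); have [v v1 z2E] := SP z2 z2S.
have ras : rho * a * s != 0 by rewrite !mulf_neq0 ?(gt_eqF s0) ?(gt_eqF rhogt0).
have t1 : `|t z1| < 1.
  rewrite /t normrM normfV ltr_pdivrMr ?normr_gt0// mul1r !normrM.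
  by rewrite (gtr0_norm rhogt0) (gtr0_norm s0) -mulrA; exact: z0P.
have [y [y1 yE]] := Ay _ _ t1 v1; exists y => //.
have Fz : map_mx intr (F z1 z2) =
    (col_mx (z1%:~R)%:M (map_mx intr z2) : 'cV[R]_(1 + n)).
  by rewrite -map_scalar_mx; exact: map_col_mx.
have xE : x = (col_mx (x 0 0)%:M x' : 'cV_(1 + n)).
  rewrite -[LHS](vsubmxK (x : 'cV_(1 + n))) [usubmx _]mx11_scalar mxE.
  by rewrite lshift0.
have affine_col (u u' : 'M[R]_1) (y' y'' : 'cV[R]_n) :
    (col_mx u y' : 'cV_(1 + n)) + rho *: (s *: (col_mx u' y'' : 'cV_(1 + n))) =
    col_mx (u + rho *: (s *: u')) (y' + rho *: (s *: y'')).
  by rewrite !scale_col_mx add_col_mx.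
rewrite yE Fz [x in RHS]xE -/s; apply: etrans (esym (affine_col _ _ _ _)).
congr col_mx.
  rewrite [RHS]mx11_scalar !mxE eqxx !mulr1n; congr (_%:M).
  rewrite /t; move: ras; rewrite !mulf_eq0 !negb_or => /andP[/andP[r0 _] s00].
  by field; rewrite s00 a0 r0.
by rewrite [LHS]z2E !scalerDr addrA -!scalerA.
Qed.

End Lattice.

(** * Lower integrals of nonnegative functions *)

Section LowerIntegral.
Context {R : realType}.
Local Open Scope ereal_scope.
Local Notation mu := (@lebesgue_measure R).
Implicit Types f g : R -> \bar R.
Import HBNNSimple.

(** The integral of a nonnegative function is the supremum of the integrals of
    the simple functions below it; for a function that is not measurable, this
    is the lower integral. *)
Lemma ge0_integral_le_sup f (M : \bar R) : (forall t, 0 <= f t) ->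
  (forall g : {nnsfun (measurableTypeR R) >-> R}, (forall t, (g t)%:E <= f t) ->
     \int[mu]_t (g t)%:E <= M) ->
  \int[mu]_t f t <= M.
Proof.
move=> f0 gM; rewrite ge0_integralTE//; apply: ge_ereal_sup => _ [g gf <-].
by apply: le_trans (gM g gf); rewrite integral_nnsfun// patch_setT.
Qed.

Lemma ge0_le_integral_nonmeasurable f g : (forall t, 0 <= f t) ->
  (forall t, f t <= g t) -> \int[mu]_t f t <= \int[mu]_t g t.
Proof.
move=> f0 fg; have g0 t : 0 <= g t := le_trans (f0 t) (fg t).
apply: ge0_integral_le_sup => // h hf.
rewrite integral_nnsfun// patch_setT ge0_integralTE//.
by apply: ereal_sup_ubound; exists h => // t; exact: le_trans (fg t).
Qed.

Lemma ge0_integral_opp_le f : (forall t, 0 <= f t) ->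
  \int[mu]_t f t <= \int[mu]_t f (- t)%R.
Proof.
move=> f0; apply: ge0_integral_le_sup => // g gf.
apply: (@le_trans _ _ (\int[mu]_t (g (- t)%R)%:E)); last first.
  apply: ge0_le_integral_nonmeasurable => t; last exact: gf.
  by rewrite lee_fin.
have mg : @measurable_fun _ _ (measurableTypeR R) (\bar R) setT (EFin \o g) by exact/measurable_EFinP.
apply: (@le_trans _ _ (\int[pushforward mu (-%R : R -> measurableTypeR R)]_t (g t)%:E)).
  rewrite le_eqVlt; apply/orP; left; apply/eqP.
  by apply: eq_measure_integral => /= A mA _; exact/esym/lebesgue_measureN.
have mN : @measurable_fun _ _ (measurableTypeR R) (measurableTypeR R) setT (-%R) by [].
rewrite (ge0_integral_pushforward mN)//; last by move=> t _; rewrite lee_fin.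
Qed.

Lemma ge0_integral_opp f : (forall t, 0 <= f t) ->
  \int[mu]_t f (- t)%R = \int[mu]_t f t.
Proof.
move=> f0; apply/eqP; rewrite eq_le ge0_integral_opp_le// andbT.
have := @ge0_integral_opp_le (fun t => f (- t)%R) (fun t => f0 _).
by under [X in _ <= X]eq_integral do rewrite opprK.
Qed.

(** Subadditivity fails for lower integrals in general, but it holds when the
    two parts live on complementary half-lines: simple functions can be cut. *)
Lemma ge0_integral_split f f1 f2 : (forall t, 0 <= f t) ->
  (forall t, 0 <= f1 t) -> (forall t, 0 <= f2 t) ->
  (forall t, (t <= 0)%R -> f t <= f1 t) -> (forall t, (0 < t)%R -> f t <= f2 t) ->
  \int[mu]_t f t <= \int[mu]_t f1 t + \int[mu]_t f2 t.
Proof.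
move=> f0 f10 f20 ff1 ff2; apply: ge0_integral_le_sup => // g gf.
have mg : @measurable_fun _ _ (measurableTypeR R) (\bar R) setT (EFin \o g) by exact/measurable_EFinP.
rewrite -[X in \int[_]_(_ in X) _](setUv [set t : R | (t <= 0)%R]).
have mA : measurable [set t : R | (t <= 0)%R].
  by rewrite -set_itvNyc; exact: measurable_itv.
rewrite ge0_integral_setU//=; first last.
- by apply/disj_setPCl.
- by move=> t _; rewrite lee_fin.
- by rewrite setUv.
- exact: measurableC.
rewrite integral_mkcond [X in _ + X]integral_mkcond.
have g0 (A : set R) t : 0 <= ((fun x => (g x)%:E) \_ A) t.
  by apply: erestrict_ge0 => x _; rewrite lee_fin.
apply: leeD; apply: ge0_le_integral_nonmeasurable => // t; rewrite /patch.
  by case: ifPn => // /set_mem /= t0; exact: le_trans (gf t) (ff1 _ t0).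
case: ifPn => // /set_mem /= /negP; rewrite -ltNge => t0.
exact: le_trans (gf t) (ff2 _ t0).
Qed.

End LowerIntegral.

Section IntegralRn.
Context {R : realType}.
Local Open Scope ereal_scope.

Lemma integral_Rn_ge0 n (f : 'cV[R]_n -> \bar R) : (forall x, 0 <= f x) ->
  0 <= integral_Rn f.
Proof.
elim: n f => [|n IH] f f0 /=; first exact: f0.
by apply: integral_ge0 => t _; exact: IH.
Qed.

Lemma le_integral_Rn n (f g : 'cV[R]_n -> \bar R) : (forall x, 0 <= f x) ->
  (forall x, f x <= g x) -> integral_Rn f <= integral_Rn g.
Proof.
elim: n f g => [|n IH] f g f0 fg /=; first exact: fg.
apply: ge0_le_integral_nonmeasurable => t; first exact: integral_Rn_ge0.
exact: IH.
Qed.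

Lemma integral_Rn0 n : integral_Rn (fun _ : 'cV[R]_n => 0) = 0.
Proof.
elim: n => [|n IH] //=.
by under eq_integral do rewrite IH; rewrite integral0.
Qed.

Lemma opp_col_mx_scalar n (t : R) (y : 'cV[R]_n) :
  (- (col_mx (t%:M : 'cV[R]_1) y : 'cV[R]_n.+1) = col_mx (- t)%:M (- y))%R.
Proof. by rewrite [LHS](opp_col_mx (t%:M : 'cV[R]_1) y) -raddfN. Qed.

Lemma integral_Rn_opp n (f : 'cV[R]_n -> \bar R) : (forall x, 0 <= f x) ->
  integral_Rn (fun x => f (- x)%R) = integral_Rn f.
Proof.
elim: n f => [|n IH] f f0 /=.
  by congr f; apply/matrixP => -[].
rewrite -[RHS]ge0_integral_opp; last by move=> t; exact: integral_Rn_ge0.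
apply: eq_integral => t _.
rewrite -[RHS]IH; last by move=> y; exact: f0.
congr integral_Rn; apply/funext => y; congr f.
exact: opp_col_mx_scalar.
Qed.

(** The reflected half-space carries the same mass of the even density [f], and
    the two together carry all of it. *)
Lemma half_mass n (f g : 'cV[R]_n.+1 -> \bar R) :
  (forall x, 0 <= f x) -> (forall x, f (- x)%R = f x) -> integral_Rn f = 1 ->
  (forall x, 0 <= g x) -> (forall x : 'cV[R]_n.+1, (x ord0 ord0 <= 0)%R -> f x <= g x) ->
  (2^-1)%:E <= integral_Rn g.
Proof.
move=> f0 fN f1 g0 fg.
pose F t := integral_Rn (fun y : 'cV[R]_n => f (col_mx (t%:M : 'cV[R]_1) y)).
pose G t := integral_Rn (fun y : 'cV[R]_n => g (col_mx (t%:M : 'cV[R]_1) y)).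
have F0 t : 0 <= F t by exact: integral_Rn_ge0.
have G0 t : 0 <= G t by exact: integral_Rn_ge0.
have FN t : F (- t)%R = F t.
  rewrite /F -[RHS]integral_Rn_opp; last by move=> y; exact: f0.
  congr integral_Rn; apply/funext => y.
  by rewrite -[LHS]fN opp_col_mx_scalar opprK.
have FG t : (t <= 0)%R -> F t <= G t.
  move=> t0; apply: le_integral_Rn => y; first exact: f0.
  by apply: fg; rewrite mxE; case: splitP => // j _; rewrite !mxE ord1 eqxx.
have : integral_Rn f <= integral_Rn g + integral_Rn g.
  rewrite [in X in _ <= X + _]/= -[X in _ <= _ + X]ge0_integral_opp//.
  apply: (@ge0_integral_split _ F G (fun t => G (- t)%R)) => // t t0.
  by rewrite -[X in X <= _]FN FG// lerNl oppr0 ltW.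
rewrite f1; have := integral_Rn_ge0 g0; case: (integral_Rn g) => //= [r|] _.
  by rewrite -EFinD !lee_fin => h; lra.
by move=> _; rewrite leey.
Qed.

End IntegralRn.

(** * The function [w] *)

Section Scale.
Context {R : realType} {d : nat}.
Variable B : 'M[R]_d.+1.
Hypothesis eB : expanding B.

Let q_gt0 : 0 < `|\det B| := lt_trans ltr01 (det_expanding eB).

Lemma scale_gt0 k : 0 < scale B k.
Proof. exact: powR_gt0. Qed.

Lemma scale0 : scale B 0 = 1.
Proof. by rewrite /scale mul0r oppr0 powRr0. Qed.

Lemma scaleD j k : scale B (j + k) = scale B j * scale B k.
Proof.
rewrite /scale intrD mulrDl opprD powRD//.
by apply/implyP => _; rewrite gt_eqF.
Qed.

Lemma scaleN k : scale B (- k) = (scale B k)^-1.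
Proof.
have k0 : scale B k != 0 by rewrite gt_eqF ?scale_gt0.
by apply: (mulIf k0); rewrite mulVf// -scaleD addNr scale0.
Qed.

Lemma scale_nat (n : nat) : scale B n = scale B 1 ^+ n.
Proof.
elim: n => [|n IH]; first by rewrite scale0 expr0.
by rewrite exprS -IH -scaleD -intS.
Qed.

Lemma scale1_lt1 : scale B 1 < 1.
Proof.
rewrite /scale powRN invf_lt1 ?powR_gt0//.
have e1 : 1 `^ (1%:~R / d.+1%:R) = 1 :> R by rewrite powR1.
rewrite -[ltLHS]e1 gt0_ltr_powR ?det_expanding ?nnegrE//.
Qed.

End Scale.

Lemma esum_Zl_le {R : realType} (T : choiceType) (c : R) (a : T -> \bar R) :
  0 < c -> (forall k, 0 <= a k)%E ->
  (\esum_(k in [set: T]) (c%:E * a k) <= c%:E * \esum_(k in [set: T]) a k)%E.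
Proof.
move=> c0 a0; apply: ge_ereal_sup => _ [X [fX _] <-].
rewrite -ge0_mule_fsumr// lee_pmul2l ?lte_fin//.
by apply: ereal_sup_ubound; exists X.
Qed.

Lemma esum_Zl {R : realType} (T : choiceType) (c : R) (a : T -> \bar R) :
  0 < c -> (forall k, 0 <= a k)%E ->
  (\esum_(k in [set: T]) (c%:E * a k) = c%:E * \esum_(k in [set: T]) a k)%E.
Proof.
move=> c0 a0; apply/eqP; rewrite eq_le esum_Zl_le//=.
have cV0 : 0 < c^-1 by rewrite invr_gt0.
have ca0 k : (0 <= c%:E * a k)%E by rewrite mule_ge0// lee_fin ltW.
have := esum_Zl_le cV0 ca0; under eq_esum do
  rewrite muleA -EFinM mulVf ?gt_eqF// mul1e.
by rewrite -(lee_pmul2l _ (_ : (0 < c%:E)%E)) ?lte_fin// muleA -EFinM mulfV ?gt_eqF// mul1e.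
Qed.

Section Wseries.
Context {R : realType} {d : nat}.
Variables (B : 'M[R]_d.+1) (N : 'cV[R]_d.+1 -> R) (delta : R)
  (phi : 'cV[R]_d.+1 -> R).
Hypotheses (eB : expanding B) (nN : is_norm N) (delta_half : delta < 2^-1)
  (mphi : mollifier N delta phi).
Local Notation V := 'cV[R]_d.+1.

Let h (z : V) := convolution \1_(annulus B N) phi z.
Let W (x : V) := (\esum_(k in [set: int])
  ((scale B k)%:E * h ((B ^ k) *m x)))%E.

Let phi_ge0 x : 0 <= phi x. Proof. by have [_ + _ _ _] := mphi; exact. Qed.

Lemma mollifier_support x : phi x != 0 -> N x < delta.
Proof. by have [_ _ + _ _] := mphi => s x0; apply: s; exact: subset_closure. Qed.

Lemma convolution_ge0 z : (0 <= h z)%E.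
Proof.
by apply: integral_Rn_ge0 => y; rewrite lee_fin mulr_ge0.
Qed.

Lemma convolution_le1 z : (h z <= 1)%E.
Proof.
have [_ _ _ _ <-] := mphi; apply: le_integral_Rn => y; rewrite lee_fin.
  by rewrite mulr_ge0.
by rewrite ler_piMl// indicE lern1 leq_b1.
Qed.

Lemma convolution_eq0 z : N z < 2^-1 -> h z = 0%E.
Proof.
move=> z2; rewrite -[RHS](@integral_Rn0 R d.+1); congr integral_Rn.
apply/funext => y; have [->|/mollifier_support y0] := eqVneq (phi y) 0.
  by rewrite mulr0.
rewrite indicE memNset ?mul0r// => -[_]; apply; rewrite /nball /=.
have [ND NZ _] := nN; apply: (le_lt_trans (ND _ _)).
rewrite -scaleN1r NZ normrN1 mul1r.
by rewrite (lt_le_trans (ltrD z2 (lt_trans y0 delta_half)))// -div1r -splitr.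
Qed.

Lemma wseries_term_ge0 x k : (0 <= (scale B k)%:E * h ((B ^ k) *m x))%E.
Proof. by rewrite mule_ge0 ?convolution_ge0// lee_fin ltW ?scale_gt0. Qed.

Lemma wseries_ge0 x : 0 <= wseries B N phi x.
Proof. by apply: fine_ge0; apply: esum_ge0 => k _; exact: wseries_term_ge0. Qed.

(** Below a scale depending on the bound [r] the terms vanish, and above it they
    are dominated by a geometric series of ratio [scale B 1 < 1]. *)
Lemma esum_bounded (r : R) : exists C : R, forall x, `|x| <= r -> (W x <= C%:E)%E.
Proof.
have [cN cN0 NcN] := is_norm_le_sup nN.
have [c [rho [c0 /andP[rho0 rho1] cB]]] := expanding_contraction eB.
have [k0 k0P] : exists k0 : nat, forall k, (k0 <= k)%N ->
    cN * (c * rho ^+ k * `|r|) < 2^-1.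
  have : cN * c * `|r| * rho ^+ k @[k --> \oo] --> cN * c * `|r| * 0.
    by apply: cvgMr; apply: cvg_expr; rewrite ger0_norm// ltW.
  rewrite mulr0 => /cvgrPdist_lt /(_ 2^-1 ltac:(by rewrite invr_gt0)).
  move=> [k0 _ kP]; exists k0 => k /kP /=; rewrite sub0r normrN => lt2.
  apply: le_lt_trans lt2; rewrite (le_trans _ (ler_norm _))//.
  by rewrite le_eqVlt; apply/orP; left; apply/eqP; ring.
pose q := scale B 1; have q1 : q < 1 := scale1_lt1 eB.
have q0 : 0 < q := scale_gt0 eB 1.
pose s := scale B (- k0%:Z); have s0 : 0 < s := scale_gt0 eB _.
exists (s / (1 - q)) => x xr.
pose e (i : nat) : int := i%:Z - k0%:Z.
have e_inj : set_inj [set: nat] e by move=> i j _ _ /addIr [].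
have hle k : ((scale B k)%:E * h ((B ^ k) *m x) <=
    if k \in range e then (scale B k)%:E else 0)%E.
  case: ifPn => [_|/negP ke].
    rewrite -[leRHS]mule1 lee_pmul2l ?convolution_le1//.
    by rewrite lte_fin scale_gt0.
  suff [n nk0 ->] : exists2 n : nat, (k0 <= n)%N & k = - n%:Z.
    rewrite convolution_eq0 ?mule0// -exprnN.
    apply: (le_lt_trans (NcN _)); apply: (le_lt_trans _ (k0P _ nk0)).
    rewrite (ler_wpM2l (ltW cN0))//; apply: (le_trans (cB _ _)).
    rewrite ler_wpM2l ?(le_trans xr) ?ler_norm//.
    by rewrite mulr_ge0 ?exprn_ge0// ltW.
  have kk0 : k + k0%:Z < 0.
    rewrite ltNge; apply/negP => kk; apply: ke; apply/mem_set.
    exists (absz (k + k0%:Z)) => //.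
    by rewrite /e gez0_abs// addrK.
  exists (absz k); lia.
apply: (@le_trans _ _ (\esum_(k in [set: int])
    if k \in range e then (scale B k)%:E else 0)%E); first exact: le_esum.
rewrite -esum_mkcond esum_image// -nneseries_esumT; last first.
  by move=> i; rewrite lee_fin ltW ?scale_gt0.
apply: lime_le.
  by apply: is_cvg_nneseries => i _ _; rewrite lee_fin ltW ?scale_gt0.
apply: nearW => n; rewrite sumEFin lee_fin.
have -> : \sum_(0 <= i < n) scale B (e i) = s * \sum_(0 <= i < n) q ^+ i.
  rewrite mulr_sumr; apply: eq_bigr => i _.
  by rewrite /e addrC scaleD// scale_nat.
rewrite (ler_wpM2l (ltW s0))// -[leRHS]mul1r ler_pdivlMr ?subr_gt0//.
have := subrX1 q n; rewrite big_mkord => e1.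
have : 0 <= q ^+ n by rewrite exprn_ge0// ltW.
set S := \sum_(i < n) _ in e1 *; lra.
Qed.

Lemma esum_fin_num x : W x \is a fin_num.
Proof.
have [C Cx] := esum_bounded `|x|; rewrite ge0_fin_numE.
  by rewrite (le_lt_trans (Cx x _))// ltry.
by apply: esum_ge0 => k _; exact: wseries_term_ge0.
Qed.

Lemma wseries_bounded (r : R) : exists2 C : R, 0 < C &
  forall x, `|x| <= r -> wseries B N phi x <= C.
Proof.
have [C Cx] := esum_bounded r; exists (`|C| + 1) => [|x /Cx xC].
  by rewrite ltr_wpDl.
rewrite (@le_trans _ _ C)//; last by rewrite (le_trans (ler_norm _))// lerDl.
by rewrite -lee_fin fineK// esum_fin_num.
Qed.

Lemma convolution_le_wseries x : fine (h x) <= wseries B N phi x.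
Proof.
apply: fine_le; rewrite ?esum_fin_num//.
  rewrite ge0_fin_numE ?convolution_ge0//.
  by rewrite (le_lt_trans (convolution_le1 x))// ltry.
apply: esum_ge; exists [set 0].
  by split; [exact: finite_set1|].
by rewrite fsbig_set1 scale0// mul1e expr0z mul1mx.
Qed.

Lemma wseries0 : wseries B N phi 0 = 0.
Proof.
have h0 : h 0 = 0%E.
  apply: convolution_eq0; have [_ NZ _] := nN.
  by rewrite -(scale0r 0) NZ normr0 mul0r invr_gt0.
by rewrite /wseries esum1// => k _; rewrite mulmx0 -/(h 0) h0 mule0.
Qed.

(** Reindexing the bi-infinite series by a shift. *)
Lemma wseries_scale (j : int) x :
  wseries B N phi (B ^ j *m x) = scale B (- j) * wseries B N phi x.
Proof.
rewrite /wseries -/(W _) -/(W _).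
suff -> : W (B ^ j *m x) = ((scale B (- j))%:E * W x)%E.
  by rewrite fineM// esum_fin_num.
have sj := scale_gt0 eB (- j).
have shift : set_bij [set: int] [set: int] (fun k => k - j).
  split => [//|k l _ _ /addIr //|k _].
  by exists (k + j) => //; rewrite addrK.
rewrite /W [LHS](reindex_esum _ _ _ _ shift) -esum_Zl//; last first.
  by move=> k; exact: wseries_term_ge0.
apply: eq_esum => k _; rewrite muleA -EFinM -scaleD// [- j + k]addrC; congr (_ * h _)%E.
rewrite mulmxA; congr (_ *m x).
by rewrite -[in RHS](subrK j k) [RHS]exprzDr ?expanding_unit.
Qed.

End Wseries.

(** * Coded sets *)

(** The properties of [w] on which the coding relies; the lower bounds come from
    condition (H_w). *)
Definition gauge (R : realType) d (B : 'M[R]_d.+1) (w : 'cV[R]_d.+1 -> R) :=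
  [/\ w 0 = 0, forall x, 0 <= w x,
      forall (j : int) x, w (B ^ j *m x) = scale B (- j) * w x
    & forall r : R, exists2 C : R, 0 < C & forall x, `|x| <= r -> w x <= C].

Lemma ultrametric_gauge (R : realType) d (B : 'M[R]_d.+1) w :
  expanding B -> ultrametric B w -> gauge B w.
Proof.
move=> eB [N [delta [phi [nN _ /andP[_ d2] mphi ->]]]]; split.
- exact: wseries0 nN d2 mphi.
- exact: wseries_ge0 eB mphi.
- exact: wseries_scale eB nN d2 mphi.
- exact: wseries_bounded eB nN d2 mphi.
Qed.

Definition first_diff (T : Type) (a b : nat -> T) n :=
  (forall k, (k < n)%N -> a k = b k) /\ a n <> b n.

Lemma first_diff_unique T (a b : nat -> T) n n' :
  first_diff a b n -> first_diff a b n' -> n = n'.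
Proof.
by move=> [an bn] [an' bn']; have [/an'|/an|//] := ltngtP n n'.
Qed.

(** [K] is bilipschitz to the space of sequences over [m] letters, where two
    sequences that part at time [n] are at distance [s n]. *)
Definition coded (R : realType) d m (s : nat -> R) (w : 'cV[R]_d.+1 -> R)
    (K : set 'cV[R]_d.+1) :=
  exists (pi : 'cV[R]_d.+1 -> nat -> 'I_m) (c C : R),
    [/\ 0 < c, 0 < C, forall om, exists2 x, K x & pi x = om &
    forall x y, K x -> K y -> x <> y -> exists2 n, first_diff (pi x) (pi y) n &
      c * s n <= w (x - y) <= C * s n].

Lemma coded_lipschitz (R : realType) d m (s : nat -> R)
    (w w' : 'cV[R]_d.+1 -> R) (K K' : set 'cV[R]_d.+1) :
  w 0 = 0 -> w' 0 = 0 -> (forall n, 0 < s n) ->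
  coded m s w K -> coded m s w' K' -> lipschitz_equiv w K w' K'.
Proof.
move=> w0 w'0 s0 [pi [c [C [c0 C0 pi_surj piP]]]].
move=> [pi' [c' [C' [c'0 C'0 pi'_surj pi'P]]]].
pose sg x := s2val (cid2 (pi'_surj (pi x))).
have K'sg x : K' (sg x) by exact: s2valP (cid2 (pi'_surj (pi x))).
have pisg x : pi' (sg x) = pi x by exact: s2valP' (cid2 (pi'_surj (pi x))).
have piI x y : K x -> K y -> pi x = pi y -> x = y.
  move=> Kx Ky e; apply: contrapT => xy.
  by have [n [_ +] _] := piP _ _ Kx Ky xy; rewrite e.
have pi'I x y : K' x -> K' y -> pi' x = pi' y -> x = y.
  move=> Kx Ky e; apply: contrapT => xy.
  by have [n [_ +] _] := pi'P _ _ Kx Ky xy; rewrite e.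
have CC0 : 0 < C / c' + C' / c by rewrite addr_gt0 ?divr_gt0.
exists sg, (C / c' + C' / c); split => //.
  split => [x _|x y /set_mem Kx /set_mem Ky e|y Ky] /=; first exact: K'sg.
    by apply: piI => //; rewrite -!pisg e.
  have [x Kx xy] := pi_surj (pi' y); exists x => //.
  by apply: pi'I => //; rewrite pisg.
move=> x y Kx Ky; have [->|/eqP xy] := eqVneq x y.
  by rewrite !subrr w0 w'0 !mulr0 lexx.
have [n fd /andP[wl wu]] := piP _ _ Kx Ky xy.
have sgxy : sg x <> sg y.
  by move=> e; apply: xy; apply: piI => //; rewrite -!pisg e.
have [n' + /andP[w'l w'u]] := pi'P _ _ (K'sg x) (K'sg y) sgxy.
rewrite !pisg => /(first_diff_unique fd) nn'; rewrite -{n'}nn' in w'l w'u.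
have sn := s0 n; set a := w (x - y) in wl wu *; set a' := w' _ in w'l w'u *.
have a_gt0 : 0 < a := lt_le_trans (mulr_gt0 c0 sn) wl.
apply/andP; split.
  rewrite mulrC ler_pdivrMr//.
  have h : a <= C / c' * a'.
    rewrite (le_trans wu)// -mulrA ler_pM2l// mulrC ler_pdivlMr// mulrC//.
  rewrite mulrC (le_trans h)// ler_wpM2r//; last by rewrite lerDl ltW// divr_gt0.
  by rewrite (le_trans _ w'l)// mulr_ge0// ltW.
have h : a' <= C' / c * a.
  by rewrite (le_trans w'u)// -mulrA ler_pM2l// mulrC ler_pdivlMr// mulrC.
by rewrite (le_trans h)// ler_pM2r// lerDr ltW// divr_gt0.
Qed.

(** * The number of maps is less than the determinant *)

Section Packing.
Context {R : realType}.

Lemma int_box_size n (M : nat) (s : seq 'cV[int]_n) : uniq s ->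
  (forall z, z \in s -> forall i, (`|z i 0%R| <= M%:Z)%R) ->
  (size s <= (2 * M).+1 ^ n)%N.
Proof.
move=> us sM; pose f (z : 'cV[int]_n) : {ffun 'I_n -> 'I_(2 * M).+1} :=
  [ffun i => inord (absz (z i 0 + M%:Z))].
have fI : {in s &, injective f}.
  move=> z z' zs z's /ffunP e; apply/colP => i; have := e i.
  rewrite !ffunE => /(congr1 val) /=.
  have := sM _ zs i; have := sM _ z's i; rewrite !ler_norml.
  move: (z i 0) (z' i 0) => a a' /andP[a'l a'u] /andP[al au].
  by rewrite !inordK; lia.
rewrite -(size_map f) -[X in (_ <= X ^ _)%N]card_ord -[n in X in (_ <= X)%N]card_ord.
rewrite -card_ffun.
have /card_uniqP <- : uniq (map f s) by rewrite map_inj_in_uniq.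
exact: max_card.
Qed.

End Packing.

Section DetBound.
Context {R : realType} {d m : nat}.
Variables (B : 'M[R]_d.+1) (w : 'cV[R]_d.+1 -> R) (K : set 'cV[R]_d.+1).
Hypotheses (eB : expanding B) (gw : gauge B w).
Local Notation V := 'cV[R]_d.+1.

(** A small ball around the origin is mapped by [B ^ j] into the unit ball, where
    [w] is bounded, and [w] shrinks by the factor [scale B j] on the way back. *)
Lemma gauge_small (c : R) : 0 < c ->
  exists2 r : R, 0 < r & forall z, `|z| < r -> w z < c.
Proof.
move=> c0; have [_ w0 wB wb] := gw; have [C C0 Cw] := wb 1.
have [j jc] : exists j : nat, scale B j * C < c.
  have q1 : `|scale B 1| < 1 by rewrite ger0_norm ?scale1_lt1// ltW ?scale_gt0.
  have : C * scale B 1 ^+ k @[k --> \oo] --> C * 0 by apply: cvgMr; exact: cvg_expr.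
  rewrite mulr0 => /cvgrPdist_lt /(_ c c0) [j _ /(_ j (leqnn j)) /=].
  rewrite sub0r normrN => h; exists j; rewrite scale_nat// mulrC.
  by rewrite (le_lt_trans (ler_norm _)).
pose D : R := d.+1%:R * `|B ^+ j| + 1.
have D0 : 0 < D by rewrite ltr_wpDl// mulr_ge0.
exists D^-1 => [|z zD]; first by rewrite invr_gt0.
have -> : z = B ^ (- j%:Z) *m (B ^ j%:Z *m z).
  by rewrite mulmxA -[_ *m B ^ _]exprzDr ?expanding_unit// addNr mul1mx.
rewrite wB opprK (le_lt_trans _ jc)// ler_pM2l ?scale_gt0//; apply: Cw.
rewrite (le_trans (norm_mulmx _ _))// (@le_trans _ _ (D * `|z|))//.
  by rewrite ler_wpM2r// lerDl.
by rewrite mulrC -ler_pdivlMr// mul1r ltW.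
Qed.

Lemma scale_ge1 (j : nat) : 1 <= scale B (- j%:Z).
Proof.
rewrite scaleN// scale_nat// -exprVn exprn_ege1// invf_ge1 ?scale_gt0//.
by rewrite ltW// scale1_lt1.
Qed.

Lemma det_inv_power n : `|\det (B ^- n)| = `|\det B| ^- n.
Proof.
rewrite -[_^-1]/(invmx _) det_inv normfV; congr (_^-1).
elim: n => [|n IH]; first by rewrite !expr0 det1 normr1.
by rewrite !exprS -IH -normrM -det_mulmx.
Qed.

Lemma bounded_set_norm (A : set V) : bounded_set A ->
  exists2 M : R, 0 < M & forall x, A x -> `|x| <= M.
Proof.
move=> [M [_ AM]]; exists (`|M| + 1) => [|x Ax]; first by rewrite ltr_wpDl.
by apply: AM => //; rewrite (le_lt_trans (ler_norm _))// ltrDl.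
Qed.

Lemma mulmx_powK n (z : V) : B ^- n *m (B ^+ n *m z) = z.
Proof.
rewrite mulmxA -[_ *m B ^+ n]/(B ^- n * B ^+ n) mulVr ?mul1mx//.
by rewrite unitrX// expanding_unit.
Qed.

Lemma mulmx_powVK n (z : V) : B ^+ n *m (B ^- n *m z) = z.
Proof.
rewrite mulmxA -[_ *m B ^- n]/(B ^+ n * B ^- n) mulrV ?mul1mx//.
by rewrite unitrX// expanding_unit.
Qed.

(** The sets [B ^- n (p_u + Q)] used in the packing argument: for a word [u] of
    length [n], [p_u] lies at distance at most [r] from [B ^ n] of the cylinder
    of [u], and at distance at least [r / 4] from [B ^ n K]. Moving from a
    cylinder point with extremal first coordinate outwards along the first axis
    produces such a point, since the cylinders of the other words of length [n]
    are [r]-separated from that of [u]. *)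
Lemma packing_centers : (0 < m)%N -> compact K -> coded m (scale B) w K ->
  exists (r L : R) (a p : seq 'I_m -> V), [/\ 0 < r, 0 < L,
    forall u, [/\ K (a u), `|a u| <= L & `|p u - B ^+ size u *m a u| <= r / 2],
    forall u x, K x -> r / 4 <= `|p u - B ^+ size u *m x|
  & forall u v, size u = size v -> u <> v -> r <= `|p u - p v|].
Proof.
move=> m0 cK [pi [c [C [c0 C0 pi_surj piP]]]]; pose i0 : 'I_m := Ordinal m0.
have [r r0 small] := gauge_small c0.
pose pre x n := mkseq (pi x) n.
have sep n x y : K x -> K y -> pre x n <> pre y n -> r <= `|B ^+ n *m (x - y)|.
  move=> Kx Ky xy; rewrite leNgt; apply/negP => /small.
  have xy' : x <> y by move=> e; apply: xy; rewrite e.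
  have [k [kxy _] /andP[wl _]] := piP _ _ Kx Ky xy'.
  have kn : (k <= n)%N.
    rewrite leqNgt; apply/negP => nk; apply: xy; apply/eq_in_map => j.
    by rewrite mem_iota add0n => /andP[_ jn]; apply: kxy; exact: ltn_trans nk.
  have [_ w0 wB _] := gw; rewrite -[B ^+ n]/(B ^ n%:Z) wB; apply/negP.
  rewrite -leNgt (@le_trans _ _ (scale B (- n%:Z) * (c * scale B k)))//; last first.
    by rewrite ler_pM2l ?scale_gt0.
  rewrite mulrCA -scaleD// ler_peMr ?(ltW c0)//.
  have -> : - n%:Z + k%:Z = - (n - k)%N%:Z by lia.
  exact: scale_ge1.
have [M M0 KM] := bounded_set_norm (compact_bounded cK).
have /choice[a aP] : forall u : seq 'I_m, exists a : V, [/\ K a, pre a (size u) = u &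
    forall y, K y -> pre y (size u) = u ->
    (B ^+ size u *m y) 0 0 <= (B ^+ size u *m a) 0 0 + r / 8].
  move=> u; set n := size u.
  pose E := [set (B ^+ n *m y) 0 0 | y in [set y | K y /\ pre y n = u]].
  have E0 : E !=set0.
    have [y Ky piy] := pi_surj (nth i0 u).
    by exists ((B ^+ n *m y) 0 0); exists y => //; split; rewrite // /pre piy mkseq_nth.
  have Eub : has_ubound E.
    exists (d.+1%:R * `|B ^+ n| * M) => _ [y [Ky _] <-].
    rewrite (le_trans (ler_norm _))// (le_trans (entry_le_norm _ _ _))//.
    rewrite (le_trans (norm_mulmx _ _))// ler_wpM2l ?mulr_ge0//; exact: KM.
  have r8 : 0 < r / 8 by rewrite divr_gt0.
  have [_ [b [Kb bu] <-] bsup] := sup_adherent r8 (conj E0 Eub).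
  exists b; split => // y Ky yu; rewrite -lerBlDr.
  apply: le_trans (ltW bsup); rewrite lerD2r.
  by apply: ub_le_sup => //; exists y.
pose e0 : V := delta_mx 0 0.
have e01 : `|e0| <= 1.
  by apply: norm_le_entries => // i j; rewrite mxE; case: (_ && _); rewrite ?normr1 ?normr0.
pose p u := B ^+ size u *m a u + (r / 2) *: e0.
have re0 : `|(r / 2) *: e0| <= r / 2.
  have r20 : 0 <= r / 2 by rewrite divr_ge0// ltW.
  by rewrite normrZ ger0_norm// ler_piMr.
exists r, M, a, p; split => //.
- move=> u; have [Ka _ _] := aP u; split => //; first exact: KM.
  by rewrite /p addrC addKr.
- move=> u x Kx; have [Ka au amax] := aP u.
  have [xu|xu] := pselect (pre x (size u) = u).
    have := amax _ Kx xu; set n := size u => xa.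
    apply: le_trans (entry_le_norm _ 0 0); apply: le_trans (ler_norm _).
    rewrite !mxE eqxx mulr1 /=; rewrite !mxE in xa; lra.
  have : r <= `|B ^+ size u *m (a u - x)| by apply: sep => //; rewrite au => /esym.
  have -> : B ^+ size u *m (a u - x) =
      (p u - B ^+ size u *m x) - (r / 2) *: e0.
    by rewrite mulmxBr /p addrAC addrK.
  have := ler_normB (p u - B ^+ size u *m x) ((r / 2) *: e0); lra.
- move=> u v uv neq; have [Kau au _] := aP u; have [Kav av _] := aP v.
  have -> : p u - p v = B ^+ size u *m (a u - a v).
    by rewrite /p -uv opprD addrACA subrr addr0 mulmxBr.
  by apply: sep => //; rewrite au uv av.
Qed.

(** A packing argument: if [m >= |det B|], each of [N] regularly spaced levels
    contributes, when [n] is its height, [m ^ n] disjoint pieces of volume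
    [cst * |det B| ^- n] to a bounded region whose volume does not depend on
    [N]. Volume is measured by counting points of a fine lattice. *)
Lemma coded_lt_det : compact K -> coded m (scale B) w K -> m%:R < `|\det B|.
Proof.
move=> cK codK; have [m0|m0] := posnP m.
  by rewrite m0 (lt_trans ltr01)// det_expanding.
rewrite ltNge; apply/negP => qm.
have [r [M [a [p [r0 M0 aP far sep]]]]] := packing_centers m0 cK codK.
have [cB [rho [cB0 /andP[rho0 rho1] BP]]] := expanding_contraction eB.
have [k0 k0P] : exists k0 : nat, forall j, (k0 <= j)%N -> cB * rho ^+ j * r < r / 8.
  have : cB * r * rho ^+ j @[j --> \oo] --> cB * r * 0.
    by apply: cvgMr; apply: cvg_expr; rewrite ger0_norm// ltW.
  have r8 : 0 < r / 8 by rewrite divr_gt0.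
  rewrite mulr0 => /cvgrPdist_lt /(_ _ r8) [k0 _ kP]; exists k0 => j /kP /=.
  by rewrite sub0r normrN => /(le_lt_trans (ler_norm _)); rewrite mulrAC.
pose k1 := k0.+1.
(* the levels are [k1] apart, so that finer neighbourhoods are thin enough *)
have k1_lt l l' : (l < l')%N -> (k1 * l + k0 <= k1 * l')%N.
  move=> ll'; apply: leq_trans (leq_mul (leqnn k1) ll').
  by rewrite mulnS [leqRHS]addnC leq_add2l.
pose G u z := `|B ^+ size u *m z - p u| < r / 16.
have Gnear u z : G u z -> `|B ^+ size u *m z - B ^+ size u *m a u| <= r.
  have [_ _ pa] := aP u; rewrite /G => Gz.
  have := ler_normD (B ^+ size u *m z - p u) (p u - B ^+ size u *m a u).
  rewrite addrA subrK; lra.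
have Gsep u v z : size u = size v -> u <> v -> G u z -> G v z -> False.
  move=> uv neq; rewrite /G uv => Guz Gvz; have := sep _ _ uv neq.
  have := ler_normB (B ^+ size v *m z - p v) (B ^+ size v *m z - p u).
  rewrite opprB addrC addrA subrK addrC; lra.
have Glevels u v z : (size u + k0 <= size v)%N -> G u z -> G v z -> False.
  move=> uv Gu Gv; have [Kav _ _] := aP v; have := far u _ Kav.
  pose j := (size v - size u)%N.
  have sv : size v = (j + size u)%N by rewrite subnK// (leq_trans _ uv)// leq_addr.
  have : `|B ^+ size u *m z - B ^+ size u *m a v| < r / 8.
    apply: le_lt_trans (k0P j _); last by rewrite leq_subRL ?(leq_trans _ uv)// leq_addr.
    have -> : B ^+ size u *m z - B ^+ size u *m a v =
        B ^- j *m (B ^+ size v *m z - B ^+ size v *m a v).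
      rewrite -!mulmxBr sv exprD -[B ^+ j * B ^+ size u]/(B ^+ j *m B ^+ size u).
      by rewrite -mulmxA mulmx_powK.
    apply: (le_trans (BP _ _)); rewrite ler_wpM2l ?Gnear//.
    by rewrite mulr_ge0 ?exprn_ge0// ltW.
  move: Gu; rewrite /G; set x := B ^+ size u *m z; set y := _ *m a v => xp xy.
  have := ler_normB (x - y) (x - p u); rewrite opprB addrC addrA subrK; lra.
pose L := M + cB * r; have L0 : 0 < L by rewrite addr_gt0// mulr_gt0.
have Gbounded u z : G u z -> `|z| <= L.
  move=> Guz; have [_ aM _] := aP u.
  have : `|z - a u| <= cB * r.
    rewrite -[z - a u](mulmx_powK (size u)) mulmxBr (le_trans (BP _ _))//.
    rewrite -mulrA ler_pM2l// (@le_trans _ _ (1 * r))//; last by rewrite mul1r.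
    apply: ler_pM => //; last exact: Gnear.
      by rewrite exprn_ge0// ltW.
    by rewrite exprn_ile1// ltW.
  have := ler_normD (z - a u) (a u); rewrite subrK /L; lra.
have [c c0 cP] := lattice_points_parallelepiped (R := R) d.+1.
pose A n : 'M[R]_d.+1 := (r / 16) *: B ^- n.
have r16 : 0 < r / 16 by rewrite divr_gt0.
have /choice[rhon rhonP] := fun n => cP (A n).
have count N : N%:R * (c * (r / 16) ^+ d.+1) <= (2 * L + 1) ^+ d.+1.
  pose rh := 1 + \sum_(l < N) `|rhon (k1 * l)%N|.
  have rh1 : 1 <= rh by rewrite lerDl sumr_ge0.
  have rh0 : 0 < rh := lt_le_trans ltr01 rh1.
  have rhP l : (l < N)%N -> rhon (k1 * l)%N <= rh.
    move=> lN; rewrite /rh (bigD1 (Ordinal lN))//= (le_trans (ler_norm _))//.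
    by rewrite addrCA lerDl addr_ge0// sumr_ge0.
  have /choice[S SP] : forall u : seq 'I_m, exists s : seq 'cV[int]_d.+1,
      rhon (size u) <= rh -> [/\ uniq s,
        forall z, z \in s -> G u (rh^-1 *: map_mx intr z)
      & c * rh ^+ d.+1 * `|\det (A (size u))| <= (size s)%:R].
    move=> u; have [rhu|_] := boolP (rhon (size u) <= rh); last by exists [::].
    have [s [us sP] ss] := rhonP _ _ rhu (rh *: (B ^- size u *m p u)).
    exists s => _; split => // z /sP[y y1 ->].
    rewrite /G scalerDr !scalerA mulVf ?gt_eqF// !scale1r mulmxDr mulmx_powVK.
    rewrite addrAC subrr add0r /A -scalemxAl -scalemxAr mulmx_powVK normrZ.
    rewrite gtr0_norm// gtr_pMr//.
    by apply: norm_lt_entries => // i j; rewrite ord1.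
  pose P := [seq tval u | l <- iota 0 N, u <- enum {: (k1 * l).-tuple 'I_m}].
  have PP u : u \in P -> exists2 l, (l < N)%N & size u = (k1 * l)%N.
    move=> /allpairsPdep[l [t [lN _ ->]]]; exists l; last exact: size_tuple.
    by move: lN; rewrite mem_iota.
  have uP : uniq P.
    apply: allpairs_uniq_dep; first exact: iota_uniq.
      by move=> l _; exact: enum_uniq.
    move=> [l t] [l' t'] _ _ /= tt'.
    have ll' : l = l'.
      have := congr1 size tt'; rewrite !size_tuple => /eqP.
      by rewrite eqn_mul2l => /eqP.
    by case: l' / ll' t' tt' => t' /val_inj ->.
  pose Q := [seq z | u <- P, z <- S u].
  have SPP u : u \in P -> _ := fun uP0 => let: ex_intro2 l lN su := PP u uP0 in
    SP u (eq_ind_r (fun n => rhon n <= rh) (rhP l lN) su).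
  have uQ : uniq Q.
    apply: allpairs_uniq_dep => // [u /SPP[]//|].
    move=> [u z] [v z'] /allpairsPdep[u1 [z1 [u1P z1S e1]]].
    move=> /allpairsPdep[u2 [z2 [u2P z2S e2]]] /= zz'.
    have [uu1 vu2] : u = u1 /\ v = u2 by split; [case: e1|case: e2].
    have zz1 : z = z1 by case: e1.
    have zz2 : z' = z2 by case: e2.
    have Gu : G u (rh^-1 *: map_mx intr z).
      by rewrite uu1 zz1; have [_ + _] := SPP _ u1P; apply.
    have Gv : G v (rh^-1 *: map_mx intr z).
      by rewrite zz' vu2 zz2; have [_ + _] := SPP _ u2P; apply.
    suff uv : u = v by case: v / uv zz' {e2 vu2 Gv} => ->.
    apply: contrapT => neq; rewrite -uu1 in u1P; rewrite -vu2 in u2P.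
    have [l _ su] := PP _ u1P; have [l' _ sv] := PP _ u2P.
    have [ll'|ll'|ll'] := ltngtP l l'.
    - by apply: (Glevels u v _ _ Gu Gv); rewrite su sv k1_lt.
    - by apply: (Glevels v u _ _ Gv Gu); rewrite su sv k1_lt.
    - by apply: (Gsep u v _ _ neq Gu Gv); rewrite su sv ll'.
  pose Mz := Num.truncn (rh * L).
  have rhL0 : 0 <= rh * L by rewrite mulr_ge0// ltW.
  have QM : (size Q <= (2 * Mz).+1 ^ d.+1)%N.
    apply: int_box_size => // z /allpairsPdep[u [z' [uP0 zS ->]]] i.
    have [_ /(_ _ zS)/Gbounded + _] := SPP _ uP0.
    rewrite normrZ gtr0_norm ?invr_gt0// mulrC ler_pdivrMr// mulrC => zL.
    have := le_trans (entry_le_norm _ i 0) zL; rewrite mxE -intr_norm.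
    move: `|z' i 0| (normr_ge0 (z' i 0)) => [k|//] _ kL.
    by rewrite lez_nat truncn_ge_nat.
  have sQ : N%:R * (c * (r / 16) ^+ d.+1) * rh ^+ d.+1 <= (size Q)%:R.
    rewrite size_allpairs_dep sumnE big_map natr_sum.
    have detA n : `|\det (A n)| = (r / 16) ^+ d.+1 * `|\det B| ^- n.
      by rewrite detZ normrM normrX gtr0_norm// det_inv_power.
    apply: (@le_trans _ _
        (\sum_(u <- P) c * rh ^+ d.+1 * `|\det (A (size u))|)); last first.
      rewrite big_seq [leRHS]big_seq; apply: ler_sum => u uP0.
      by have [_ _] := SPP _ uP0.
    rewrite big_allpairs_dep /=.
    apply: (@le_trans _ _
        (\sum_(l <- iota 0 N) c * (r / 16) ^+ d.+1 * rh ^+ d.+1)).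
      rewrite big_const_seq count_predT iter_addr_0 size_iota.
      by rewrite -[leRHS]mulr_natl !mulrA.
    apply: ler_sum => l _; rewrite big_enum /=.
    under eq_bigr do rewrite size_tuple detA.
    rewrite sumr_const card_tuple card_ord -[leRHS]mulr_natr.
    have -> : c * rh ^+ d.+1 * ((r / 16) ^+ d.+1 * `|\det B| ^- (k1 * l)) *
        (m ^ (k1 * l))%:R = c * (r / 16) ^+ d.+1 * rh ^+ d.+1 *
        (`|\det B| ^- (k1 * l) * (m ^ (k1 * l))%:R).
      by rewrite -!mulrA; congr (_ * _); rewrite mulrCA.
    rewrite ler_peMr//.
      by rewrite !mulr_ge0// ?exprn_ge0// ltW.
    have q0 : 0 < `|\det B| := lt_trans ltr01 (det_expanding eB).
    rewrite mulrC ler_pdivlMr ?exprn_gt0// mul1r natrX.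
    by rewrite lerXn2r ?nnegrE ?(ltW q0)// ler0n.
  rewrite -(ler_pM2r (exprn_gt0 d.+1 rh0)); apply: (le_trans sQ).
  apply: (@le_trans _ _ ((2 * Mz).+1 ^ d.+1)%:R); first by rewrite ler_nat.
  rewrite natrX -exprMn; have bL : 0 <= (2 * L + 1) * rh.
    by rewrite mulr_ge0 ?(ltW rh0)// addr_ge0// mulr_ge0// ltW.
  rewrite lerXn2r ?nnegrE ?ler0n// -natr1 natrM; have /andP[tM _] := truncn_itv rhL0.
  rewrite -/Mz in tM; nra.
have [N NP] : exists N : nat, (2 * L + 1) ^+ d.+1 / (c * (r / 16) ^+ d.+1) < N%:R.
  by eexists; exact: truncnS_gt.
have := count N; rewrite leNgt => /negP; apply.
by rewrite -ltr_pdivrMr// mulr_gt0// exprn_gt0.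
Qed.

End DetBound.

Local Open Scope nat_scope.

(** * Distributing components among words *)

(** Greedy packing: items are placed one after the other in bins of prescribed
    capacities, and all capacities get exhausted. An item of size [x] fits
    somewhere as soon as the total remaining capacity exceeds [#|P| (x - 1)]. *)
Lemma greedy_packing (X : eqType) (P : finType) (p0 : P) (sz : X -> nat)
    (xs : seq X) (r : P -> nat) :
  uniq xs -> \sum_(x <- xs) sz x = \sum_p r p ->
  (forall xs1 x xs2, xs = xs1 ++ x :: xs2 ->
     #|P| * (sz x).-1 < \sum_(y <- x :: xs2) sz y) ->
  exists f : X -> P, forall p, \sum_(x <- xs | f x == p) sz x = r p.
Proof.
elim: xs r => [|x xs IH] r.
  rewrite big_nil => _ /esym/eqP; rewrite sum_nat_eq0 => /forallP r0 _.
  by exists (fun=> p0) => p; rewrite big_nil; apply/esym/eqP/(implyP (r0 p)).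
move=> /= /andP[xxs uxs] sumr fits.
have [p pP] : exists p, sz x <= r p.
  apply/existsP; apply: contraLR (fits [::] x xs erefl).
  rewrite negb_exists -leqNgt sumr => /forallP small.
  rewrite -[#|P|]sum1_card big_distrl /=; apply: leq_sum => p _.
  by have := small p; rewrite -ltnNge mul1n; case: (sz x).
pose r' q := if q == p then r p - sz x else r q.
have [|xs1 y xs2 e|f fP] := IH r' uxs.
- apply/(@addnI (sz x)); move: sumr; rewrite big_cons => ->.
  rewrite (bigD1 p)//= [in RHS](bigD1 p)//= addnA /r' eqxx subnKC//.
  by congr (_ + _); apply: eq_bigr => q /negPf ->.
- by apply: (fits (x :: xs1)); rewrite e.
exists (fun y => if y == x then p else f y) => q; rewrite big_cons eqxx.
have -> : \sum_(y <- xs | (if y == x then p else f y) == q) sz y = r' q.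
  rewrite -fP big_seq_cond [RHS]big_seq_cond; apply: eq_bigl => y.
  by case: (eqVneq y x) => [->|//]; rewrite (negPf xxs).
by rewrite /r' (eq_sym q); case: (eqVneq p q) => [<-|//]; rewrite subnKC.
Qed.

(** The label of an element is its rank in its fibre. *)
Lemma label_fibres (X Y A : finType) (a0 : A) (f : X -> Y) :
  (forall y, #|[pred x | f x == y]| = #|A|) ->
  exists tau : X -> A, (forall y a, exists2 x, f x = y & tau x = a) /\
    forall x x', f x = f x' -> tau x = tau x' -> x = x'.
Proof.
move=> fA; pose F y := enum [pred x | f x == y].
have FA y : size (F y) = size (enum A) by rewrite -!cardE fA.
have inF x : x \in F (f x) by rewrite mem_enum inE.
exists (fun x => nth a0 (enum A) (index x (F (f x)))); split.
  move=> y a; have ai : index a (enum A) < size (enum A).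
    by rewrite index_mem mem_enum.
  have [x0 _] : exists x0, x0 \in F y.
    move: ai; rewrite -(FA y); case: (F y) => // x l _; exists x; exact: mem_head.
  pose x := nth x0 (F y) (index a (enum A)).
  have xF : x \in F y by rewrite mem_nth// FA.
  have fx : f x = y by move: xF; rewrite mem_enum inE => /eqP.
  exists x => //; rewrite fx /x index_uniq ?FA ?enum_uniq//.
  by rewrite nth_index// mem_enum.
move=> x x' ff'; rewrite -ff' => /(congr1 (index^~ (enum A))).
have i1 : index x (F (f x)) < size (enum A) by rewrite -(FA (f x)) index_mem.
have i2 : index x' (F (f x)) < size (enum A) by rewrite -(FA (f x)) index_mem ff'.
rewrite !index_uniq ?enum_uniq// => e.
by rewrite -(nth_index x (inF x)) e nth_index// ff'.
Qed.

Section Components.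
Variables (X : finType) (e : rel X).
Hypotheses (e_refl : reflexive e) (e_sym : symmetric e) (e_trans : transitive e).

Definition rep (u : X) : X := odflt u [pick v | e u v].

Lemma equiv_eq u v : e u v -> e u =1 e v.
Proof.
move=> uv w; apply/idP/idP; apply: e_trans => //.
by rewrite e_sym.
Qed.

Lemma equiv_rep u : e u (rep u).
Proof. by rewrite /rep; case: pickP => //= _; exact: e_refl. Qed.

Lemma equiv_rep_eq u v : e u v -> rep u = rep v.
Proof.
move=> uv; rewrite /rep (eq_pick (equiv_eq uv)).
by case: pickP => // /(_ v); rewrite e_refl.
Qed.

Lemma equiv_repE u v : (rep u == rep v) = e u v.
Proof.
apply/eqP/idP => [ruv|/equiv_rep_eq//]; apply: e_trans (equiv_rep u) _.
by rewrite ruv e_sym equiv_rep.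
Qed.

Lemma sum_over_classes (S : pred X) (F : X -> nat) :
  (forall u v, e u v -> S u = S v) ->
  \sum_(z | S z) F z =
  \sum_(y | S y && (rep y == y)) \sum_(z | e y z) F z.
Proof.
move=> Se; rewrite (partition_big rep (fun y => S y && (rep y == y))).
  apply: eq_bigr => y /andP[Sy /eqP ry]; apply: eq_bigl => z.
  rewrite -{1}ry equiv_repE e_sym; case yz: (e y z); rewrite ?andbF ?andbT//.
  by rewrite -(Se _ _ yz).
move=> z Sz; rewrite -(equiv_rep_eq (equiv_rep z)) eqxx andbT.
by rewrite -(Se _ _ (equiv_rep z)).
Qed.

End Components.

(** The combinatorics of horizontal components: [conn] is the relation of being
    in the same component, and [kind] numbers the connected classes. The field
    [tree_incidence] counts the words in the [A i j] components of kind [j]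
    below one of kind [i], whence the factor [b j]. *)
Record component_tree (m kappa : nat) (A : 'M[nat]_kappa) (b : 'I_kappa -> nat)
    (T : nat -> finType) (par : forall n, T n.+1 -> T n)
    (conn : forall n, rel (T n)) (kind : forall n, T n -> 'I_kappa) : Prop :=
  ComponentTree {
    tree_root : #|T 0| = 1;
    tree_children : forall n (u : T n), #|[pred z | par n z == u]| = m;
    tree_conn_refl : forall n, reflexive (conn n);
    tree_conn_sym : forall n, symmetric (conn n);
    tree_conn_trans : forall n, transitive (conn n);
    tree_conn_par : forall n z z', conn n.+1 z z' -> conn n (par n z) (par n z');
    tree_conn_kind : forall n u v, conn n u v -> kind n u = kind n v;
    tree_b_gt0 : forall i, 0 < b i;
    tree_card_conn : forall n u, #|conn n u| = b (kind n u);
    tree_incidence : forall n (u : T n) j,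
      #|[pred z | conn n u (par n z) && (kind n.+1 z == j)]| =
      A (kind n u) j * b j }.

Section ComponentTree.
Variables (m kappa : nat) (A : 'M[nat]_kappa) (b : 'I_kappa -> nat)
  (T : nat -> finType) (par : forall n, T n.+1 -> T n)
  (conn : forall n, rel (T n)) (kind : forall n, T n -> 'I_kappa).
Hypothesis tree : component_tree m A b par conn kind.

Let conn_refl n : reflexive (@conn n). Proof. exact: (tree_conn_refl tree). Qed.
Let conn_sym n : symmetric (@conn n). Proof. exact: (tree_conn_sym tree). Qed.
Let conn_trans n : transitive (@conn n).
Proof. exact: (tree_conn_trans tree). Qed.

Fixpoint anc s n : T (s + n) -> T n :=
  match s return T (s + n) -> T n with
  | 0 => id
  | s'.+1 => fun z => anc (@par (s' + n) z)
  end.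

Local Notation rep := (rep (@conn _)).

Let conn_rep n (u : T n) : conn u (rep u).
Proof. exact: equiv_rep. Qed.

Let rep_eq n (u v : T n) : conn u v -> rep u = rep v.
Proof. by apply: equiv_rep_eq. Qed.

Let rep_rep n (u : T n) : rep (rep u) = rep u.
Proof. by apply/esym/rep_eq/conn_rep. Qed.

Lemma conn_anc s n (z z' : T (s + n)) : conn z z' -> conn (anc z) (anc z').
Proof. by elim: s z z' => //= s IH z z' /(tree_conn_par tree)/IH. Qed.

Let sum_over_components n (S : pred (T n)) (F : T n -> nat) :
  (forall u v, conn u v -> S u = S v) ->
  \sum_(z | S z) F z =
  \sum_(y | S y && (rep y == y)) \sum_(z | conn y z) F z.
Proof. by apply: sum_over_classes. Qed.

Lemma card_components n (S : pred (T n)) j :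
  (forall u v, conn u v -> S u = S v) ->
  #|[pred z | S z && (kind z == j)]| =
  #|[pred y | [&& S y, rep y == y & kind y == j]]| * b j.
Proof.
move=> Sconn; rewrite -sum1_card (eq_bigl (fun z => S z && (kind z == j)))//.
rewrite (@sum_over_components _ (fun z => S z && (kind z == j))); last first.
  by move=> u v uv; rewrite (Sconn _ _ uv) (tree_conn_kind tree uv).
rewrite -sum1_card big_distrl /=.
rewrite [RHS](eq_bigl (fun y => S y && (kind y == j) && (rep y == y))); last first.
  by move=> y; rewrite inE; case: (S y) => //=; rewrite andbC.
apply: eq_bigr => y /andP[/andP[_ /eqP <-] _].
by rewrite mul1n -(tree_card_conn tree) -sum1_card.
Qed.

Lemma card_conn_anc s n (u : T n) j :
  #|[pred z : T (s + n) | conn u (anc z) && (kind z == j)]| =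
  (A ^+ s)%R (kind u) j * b j.
Proof.
elim: s j => [|s IH] j.
  rewrite expr0 mxE; case: eqVneq => [<-|ij]; rewrite ?mul1n ?mul0n.
    rewrite -(tree_card_conn tree); apply: eq_card => z; rewrite !inE /=.
    by case uz: (conn u z) => //; rewrite (tree_conn_kind tree uz) eqxx.
  apply: eq_card0 => z; rewrite !inE; apply/negP => /= /andP[uz /eqP zj].
  by move/eqP: ij; rewrite (tree_conn_kind tree uz).
have S_conn (y z : T (s + n)) : conn y z -> conn u (anc y) = conn u (anc z).
  move=> /conn_anc yz; apply/idP/idP => h; apply: conn_trans h _ => //.
  by rewrite conn_sym.
rewrite exprSr mxE big_distrl /=.
rewrite -sum1_card (partition_big (@par (s + n))
  (fun y => conn u (anc y))) /=; last by move=> z /andP[].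
rewrite (sum_over_components _ S_conn).
transitivity (\sum_(y : T (s + n) | conn u (anc y) && (rep y == y))
    A (kind y) j * b j).
  apply: eq_bigr => y /andP[uy _]; rewrite -(tree_incidence tree) -[RHS]sum1_card.
  rewrite [RHS](partition_big (@par (s + n)) (@conn _ y)) /=; last by move=> z /andP[].
  apply: eq_bigr => v yv; apply: eq_bigl => z; rewrite !inE /=.
  case: (eqVneq (par z) v) => [->|]; rewrite ?andbF// !andbT yv.
  by rewrite -(S_conn _ _ yv) uy.
rewrite (partition_big (@kind _) xpredT)//=; apply: eq_bigr => l _.
rewrite (eq_bigr (fun=> A l j * b j)); last by move=> y /andP[_ /eqP ->].
rewrite sum_nat_const mulnA; congr (_ * _ * _).
have := IH l; rewrite (card_components _ S_conn) => /eqP.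
rewrite eqn_pmul2r ?(tree_b_gt0 tree)// => /eqP <-.
by apply: eq_card => y; rewrite !inE andbA.
Qed.

Lemma card_anc s n (u : T n) : #|[pred z : T (s + n) | anc z == u]| = m ^ s.
Proof.
elim: s => [|s IH]; first by rewrite expn0 -(card1 u); apply: eq_card.
rewrite -sum1_card (partition_big (@par (s + n)) (fun y => anc y == u))//=.
rewrite expnS -IH mulnC -sum_nat_const; apply: eq_bigr => y yu.
rewrite -(tree_children tree y) -[RHS]sum1_card; apply: eq_bigl => z.
rewrite !inE; case: (eqVneq (par z) y) => [->|]; rewrite ?andbF ?andbT//.
Qed.

Lemma card_level n : #|T n| = m ^ n.
Proof.
have : #|T (n + 0)| = m ^ n.
  rewrite -sum1_card (partition_big (@anc n 0) xpredT)//=.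
  rewrite -[RHS]mul1n -[X in _ = X * _](tree_root tree) -sum_nat_const; apply: eq_bigr => y _.
  by rewrite -(card_anc n y) -[RHS]sum1_card; apply: eq_bigl => z; rewrite inE.
by rewrite addn0.
Qed.

Definition items s n (u : T n) : seq (T (s + n)) :=
  [seq z <- enum (T (s + n)) | conn u (anc z) && (rep z == z)].

Lemma conn_anc_conn s n (u : T n) (y z : T (s + n)) :
  conn y z -> conn u (anc y) = conn u (anc z).
Proof.
move=> /conn_anc yz; apply/idP/idP => h; apply: conn_trans h _ => //.
by rewrite conn_sym.
Qed.

Lemma sum_items s n (u : T n) (P : pred (T (s + n))) (F : T (s + n) -> nat) :
  \sum_(x <- items s u | P x) F x =
  \sum_(x | [&& conn u (anc x), rep x == x & P x]) F x.
Proof.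
rewrite /items big_filter_cond big_enum_cond /=; apply: eq_bigl => x.
by rewrite -andbA.
Qed.

Lemma count_items s n (u : T n) j :
  \sum_(x <- items s u | kind x == j) 1 = (A ^+ s)%R (kind u) j.
Proof.
apply/eqP; rewrite -(eqn_pmul2r (tree_b_gt0 tree j)) -card_conn_anc.
rewrite (card_components j (@conn_anc_conn s n u)) sum_items -sum1_card.
by apply/eqP; congr (_ * _); apply: eq_bigl => x; rewrite inE.
Qed.

Lemma sum_b_items s n (u : T n) :
  \sum_(x <- items s u) b (kind x) = m ^ s * b (kind u).
Proof.
rewrite sum_items; transitivity (\sum_(z : T (s + n) | conn u (anc z)) 1).
  rewrite (sum_over_components _ (@conn_anc_conn s n u)).
  apply: eq_big => [x|x _]; first by rewrite andbT.
  by rewrite -(tree_card_conn tree) -sum1_card.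
rewrite (partition_big (@anc s n) (conn u))//= mulnC -(tree_card_conn tree).
rewrite -sum_nat_const; apply: eq_bigr => v uv.
rewrite -(card_anc s v) -[RHS]sum1_card; apply: eq_bigl => z; rewrite inE.
by case: (eqVneq (anc z) v) => [->|]; rewrite ?andbF// uv.
Qed.

(** Whole components are handed out to the words of the component of [u]: each
    component is listed once in [items], and weighs [b (kind x)] words. *)
Definition dealt s n (u : T n) : Prop :=
  exists f : T (s + n) -> T n, (forall x, conn u (f x)) /\
    forall v, conn u v -> \sum_(x <- items s u | f x == v) b (kind x) = m ^ s.

Lemma dealt_from_bins s n (u : T n) (g : T (s + n) -> 'I_#|conn u|) :
  (forall k, \sum_(x <- items s u | g x == k) b (kind x) = m ^ s) -> dealt s u.
Proof.
move=> gP; exists (fun x => enum_val (g x)); split=> [x|v uv].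
  by have := enum_valP (g x).
rewrite -(gP (enum_rank_in uv v)); apply: eq_bigl => x.
by rewrite -(inj_eq enum_val_inj) enum_rankK_in.
Qed.

Lemma uniq_items s n (u : T n) : uniq (items s u).
Proof. by rewrite filter_uniq// enum_uniq. Qed.

(** In the rearrangeable case each kind is distributed separately, the bin [k]
    receiving [C k j] components of kind [j]. *)
Lemma rearrangeable_dealt s n (u : T n) p (C : 'M[nat]_(p, kappa)) : 0 < m ->
  (forall j, (A ^+ s)%R (kind u) j = \sum_k C k j) ->
  (forall k, \sum_j C k j * b j = m ^ s) -> dealt s u.
Proof.
move=> m0 AC Cb; have ms0 : 0 < m ^ s by rewrite expn_gt0 m0.
have pE : p = #|conn u|.
  apply/eqP; rewrite (tree_card_conn tree) -(eqn_pmul2l ms0) -(sum_b_items s).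
  rewrite (partition_big (@kind (s + n)) xpredT)//= mulnC.
  rewrite -[p in p * _]card_ord -sum_nat_const.
  under eq_bigr => k _ do rewrite -(Cb k).
  rewrite exchange_big /=.
  apply/eqP/eq_bigr => j _; rewrite -big_distrl -AC -count_items /=.
  by rewrite big_distrl /=; apply: eq_bigr => x /eqP ->; rewrite mul1n.
subst p; have k0 : 'I_#|conn u|.
  by exists 0; rewrite (tree_card_conn tree) (tree_b_gt0 tree).
have deal j : exists f : T (s + n) -> 'I_#|conn u|,
    forall k, \sum_(x <- [seq x <- items s u | kind x == j] | f x == k) 1 = C k j.
  apply: (greedy_packing k0 (sz := fun=> 1)).
  - by rewrite filter_uniq// uniq_items.
  - by rewrite big_filter count_items AC.
  - by move=> xs1 x xs2 _; rewrite muln0 big_cons.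
have /choice[f fP] := deal.
apply: (dealt_from_bins (g := fun x => f (kind x) x)) => k.
rewrite (partition_big (@kind (s + n)) xpredT)//= -(Cb k).
apply: eq_bigr => j _; rewrite -fP big_filter_cond big_distrl /=.
rewrite (eq_bigl (fun x => (kind x == j) && (f j x == k))); last first.
  by move=> x; case: (eqVneq (kind x) j) => [->|]; rewrite ?andbT ?andbF.
by apply: eq_bigr => x /andP[/eqP -> _]; rewrite mul1n.
Qed.

(** In the primitive case the single-word components of kind [r0] are so
    numerous that the greedy packing works if they are placed last. *)
Lemma many_singletons_dealt s n (u : T n) r0 (bmax : nat) :
  b r0 = 1 -> (forall i, b i <= bmax) ->
  bmax * bmax <= (A ^+ s)%R (kind u) r0 -> dealt s u.
Proof.
move=> br0 bmaxP many.
have k0 : 'I_#|conn u|.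
  by exists 0; rewrite (tree_card_conn tree) (tree_b_gt0 tree).
pose big := [seq x <- items s u | kind x != r0].
pose one := [seq x <- items s u | kind x == r0].
have perm : perm_eq (items s u) (big ++ one).
  by rewrite perm_sym perm_catC; exact/permPl/perm_filterC.
have [|||f fP] := greedy_packing k0 (sz := fun x => b (kind x)) (xs := big ++ one)
    (r := fun=> m ^ s).
- by rewrite -(perm_uniq perm) uniq_items.
- rewrite -(perm_big _ perm) /= sum_b_items sum_nat_const card_ord.
  by rewrite (tree_card_conn tree) mulnC.
- move=> xs1 x xs2 e; rewrite card_ord (tree_card_conn tree).
  have : x \in big ++ one by rewrite e mem_cat mem_head orbT.
  rewrite big_cons; case: (eqVneq (kind x) r0) => [->|xr0].
    by rewrite br0 muln0.
  move=> _.
  (* [x] is not of kind [r0], so it comes before all the items of that kind *)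
  have lt1 : size xs1 < size big.
    rewrite ltnNge; apply/negP => le1.
    have : nth x (big ++ one) (size xs1) = x by rewrite e nth_cat ltnn subnn.
    rewrite nth_cat ltnNge le1 /= => xE.
    have : x \in one.
      rewrite -xE mem_nth// ltn_subLR// -size_cat e size_cat /=.
      by rewrite addnS ltnS leq_addr.
    by rewrite mem_filter (negPf xr0).
  have xs1E : xs1 = take (size xs1) big.
    by have := congr1 (take (size xs1)) e; rewrite take_size_cat// take_cat lt1.
  have cnt0 : \sum_(y <- xs1 | kind y == r0) 1 = 0.
    rewrite big_seq_cond big_pred0// => y; apply/negP => /andP[yxs1].
    by move: yxs1; rewrite xs1E => /mem_take; rewrite mem_filter => /andP[/negPf ->].
  have : bmax * bmax <= \sum_(y <- xs2) b (kind y).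
    apply: leq_trans many _; rewrite -count_items (perm_big _ perm) e /=.
    rewrite big_cat /= cnt0 add0n big_cons (negPf xr0).
    rewrite [leqRHS](bigID (fun y => kind y == r0)) /=.
    apply: leq_trans (leq_addr _ _).
    by apply: leq_sum => y /eqP ->; rewrite br0.
  have := bmaxP (kind x); have := bmaxP (kind u).
  have := tree_b_gt0 tree (kind x).
  move: (b (kind x)) (b (kind u)) (\sum_(y <- xs2) _) => bx bu S bx0 bub bxb.
  move=> le; apply: leq_ltn_trans (leq_mul bub (leqnn bx.-1)) _.
  have : bmax * bx.-1 <= bmax * bmax by rewrite leq_mul2l; lia.
  by lia.
apply: (dealt_from_bins (g := f)) => k.
by rewrite (perm_big _ perm) fP.
Qed.

(** A new parent map, [s] levels at a time. For this map, contrary to the true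
    ancestor map, the whole component of a word lies below a single word. *)
Definition regrouping s n (f : T (s + n) -> T n) : Prop :=
  [/\ forall z z', conn z z' -> f z = f z',
      forall z, conn (f z) (anc z)
    & forall v, #|[pred z | f z == v]| = m ^ s].

Lemma dealt_regrouping s n : (forall u : T n, dealt s u) ->
  exists f : T (s + n) -> T n, regrouping f.
Proof.
move=> /choice[g gP]; pose f z := g (rep (anc z)) (rep z).
have conn_f z : conn (f z) (anc z).
  have [gu _] := gP (rep (anc z)).
  by rewrite conn_sym; apply: conn_trans (gu _); exact: conn_rep.
exists f; split; [move=> z z' zz'|exact: conn_f|move=> v].
  by rewrite /f (rep_eq zz') (rep_eq (conn_anc zz')).
pose u := rep v; have [gu gs] := gP u.
have uv : conn u v by rewrite conn_sym conn_rep.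
rewrite -(gs v uv) sum_items -sum1_card.
transitivity (\sum_(z : T (s + n) | conn u (anc z) && (g u (rep z) == v)) 1).
  apply: eq_bigl => z; rewrite inE; apply/idP/andP => [/eqP fz|[uz gz]].
    have uz : rep (anc z) = u by apply: rep_eq; rewrite conn_sym -fz.
    by rewrite -fz /f uz eqxx -{1}uz conn_sym conn_rep.
  by rewrite /f -(rep_eq uz) rep_rep.
rewrite sum_over_components; last first.
  by move=> y z yz; rewrite (rep_eq yz) (conn_anc_conn u yz).
apply: eq_big => [y|y /andP[_ /eqP <-]]; last first.
  by rewrite -(tree_card_conn tree) -sum1_card.
by rewrite -andbA; case: (eqVneq (rep y) y) => [->|]; rewrite ?andbF ?andbT.
Qed.

Lemma trivial_regrouping s n : m = 1 ->
  exists f : T (s + n) -> T n, regrouping f.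
Proof.
move=> m1; exists (@anc s n); split; [move=> z z' _|by move=> z; exact: conn_refl|move=> v]; last first.
  exact: card_anc.
have : #|T n| <= 1 by rewrite card_level m1 exp1n.
by move=> /card_le1_eqP; apply; rewrite inE.
Qed.

Lemma rearrangeable_regrouping (bv : 'cV[nat]_kappa) n :
  0 < m -> (forall i, b i = bv i ord0) -> rearrangeable m bv A ->
  exists f : T (1 + n) -> T n, regrouping f.
Proof.
move=> m0 bE rA; apply: dealt_regrouping => u.
have [p [C [_ rowA Cb]]] := rA (kind u).
apply: (rearrangeable_dealt (C := C)) => // [j|k].
  have := congr1 (fun M : 'rV_kappa => M ord0 j) rowA.
  rewrite expr1 !mxE => ->; apply: eq_bigr => k _.
  by rewrite mxE; exact: mul1n.
have := congr1 (fun M : 'cV_p => M k ord0) Cb; rewrite !mxE expn1 => <-.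
by apply: eq_bigr => j _; rewrite bE.
Qed.

(** The entries of [A ^ s] grow at least like [m ^ s], since [A b = m b] and
    [A ^ n0] is positive. *)
Lemma primitive_regrouping : 0 < m -> primitive A -> (exists r0, b r0 = 1) ->
  exists s, 0 < s /\ forall n, exists f : T (s + n) -> T n, regrouping f.
Proof.
move=> m0 [n0 n00 An0] [r0 br0].
have [m1|m_neq1] := eqVneq m 1.
  by exists 1; split => // n; exact: trivial_regrouping.
have m2 : 1 < m by lia.
have [bmax bmaxP] : exists bmax, forall i, b i <= bmax.
  by exists (\max_i b i) => i; exact: leq_bigmax.
have bmax0 : 0 < bmax by apply: leq_trans (bmaxP r0); rewrite br0.
pose l := bmax * bmax * bmax.
exists (l + n0); split; first by rewrite addn_gt0 n00 orbT.
move=> n; apply: dealt_regrouping => u.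
apply: (many_singletons_dealt br0 bmaxP); rewrite exprD mxE.
apply: (@leq_trans (\sum_k (A ^+ l)%R (kind u) k)); last first.
  by apply: leq_sum => k _; rewrite leq_pmulr// An0.
rewrite -(leq_pmul2r bmax0) big_distrl /=.
apply: (@leq_trans (\sum_k (A ^+ l)%R (kind u) k * b k)); last first.
  by apply: leq_sum => k _; rewrite leq_mul2l bmaxP orbT.
rewrite (_ : \sum_k _ = m ^ l * b (kind u)); last first.
  rewrite -(sum_b_items l u) (partition_big (@kind (l + n)) xpredT)//=.
  apply: eq_bigr => j _; rewrite -count_items big_distrl /=.
  by apply: eq_bigr => x /eqP ->; rewrite mul1n.
rewrite -[leqLHS]muln1; apply: leq_mul; last exact: tree_b_gt0 tree _.
exact/ltnW/ltn_expl.
Qed.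

End ComponentTree.

(** * Coding points by sequences of letters *)

Section Ends.
Variables (m : nat) (T : nat -> finType) (conn : forall n, rel (T n))
  (s : nat).
Hypotheses (m0 : 0 < m) (s0 : 0 < s) (T0 : #|T 0| = 1).
Hypotheses (conn_sym : forall n, symmetric (@conn n))
  (conn_trans : forall n, transitive (@conn n)).
Variables (up : forall l, T (l.+1 * s) -> T (l * s))
  (f : forall l, T (l.+1 * s) -> T (l * s)).
Hypotheses (up_conn : forall l z z', conn z z' -> conn (@up l z) (@up l z'))
  (f_conn : forall l z z', conn z z' -> @f l z = @f l z')
  (f_up : forall l z, conn (@f l z) (up z))
  (f_card : forall l v, #|[pred z | @f l z == v]| = m ^ s).
Variables (X : Type) (K : X -> Prop) (mem : forall l, X -> T (l * s) -> Prop).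
Hypotheses (mem_ex : forall l x, K x -> exists u, mem (l := l) x u)
  (mem_up : forall l x (z : T (l.+1 * s)), K x -> mem x z -> mem x (up z))
  (mem_conn : forall l x (u v : T (l * s)), K x -> mem x u -> mem x v -> conn u v)
  (mem_limit : forall t : forall l, T (l * s),
     (forall l, conn (t l) (up (t l.+1))) ->
     exists2 x, K x & forall l, exists2 v, conn (t l) v & mem x v).

Definition same_component l (x y : X) : Prop :=
  exists u v : T (l * s), [/\ mem x u, mem y v & conn u v].

(** The address of [x]: the parents, under the new parent map, of the component
    of [x] form an infinite branch, whose edges are labelled by words of
    length [s]. *)
Lemma ends_coding : exists pi : X -> nat -> 'I_m,
  (forall om, exists2 x, K x & pi x = om) /\
  forall x y, K x -> K y -> (forall l, same_component l x y) \/
    exists n, [/\ forall k, k < n -> pi x k = pi y k, pi x n <> pi y n,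
      same_component (n %/ s) x y & ~ same_component (n %/ s).+2 x y].
Proof.
pose i0 : 'I_m := Ordinal m0.
have card_lab : #|{: s.-tuple 'I_m}| = m ^ s by rewrite card_tuple card_ord.
have /= lab l := @label_fibres _ _ _ [tuple of nseq s i0] (@f l)
  (fun v => etrans (f_card v) (esym card_lab)).
pose tau l := sval (cid (lab l)).
have tau_surj l v a : exists2 z, @f l z = v & tau l z = a.
  by have [h _] := svalP (cid (lab l)); exact: h.
have tau_inj l z z' : @f l z = @f l z' -> tau l z = tau l z' -> z = z'.
  by have [_ h] := svalP (cid (lab l)); exact: h.
have T0E (u v : T 0) : u = v.
  have /card_le1_eqP : #|T 0| <= 1 by rewrite T0.
  by apply; rewrite inE.
have /choice[u0 _] : forall x : X, exists u : T 0, True.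
  by move=> _; have /fintype1[u _] := T0; exists u.
have z_ex l x : exists z : T (l * s), K x -> mem x z.
  have [Kx|nKx] := pselect (K x); first by have [z ?] := mem_ex l Kx; exists z.
  elim: l => [|l [z _]]; first by exists (u0 x).
  by have [z' _ _] := tau_surj l z [tuple of nseq s i0]; exists z'.
pose z l x := sval (cid (z_ex l x)).
have zP l x : K x -> mem x (z l x) by exact: svalP (cid (z_ex l x)).
pose y l x := @f l (z l.+1 x).
have y_conn l x : K x -> conn (y l x) (z l x).
  move=> Kx; apply: conn_trans (f_up _) _; exact: mem_conn Kx (mem_up Kx (zP _ _ Kx)) (zP _ _ Kx).
have f_y l x : K x -> f (y l.+1 x) = y l x.
  by move=> Kx; apply: f_conn; exact: y_conn.
have same_y l x x' : K x -> K x' -> same_component l.+1 x x' -> y l x = y l x'.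
  move=> Kx Kx' [u [v [xu x'v uv]]]; apply: f_conn.
  apply: conn_trans (conn_trans uv _); first exact: mem_conn Kx (zP _ _ Kx) xu.
  exact: mem_conn Kx' x'v (zP _ _ Kx').
have y_same l x x' : K x -> K x' -> y l x = y l x' -> same_component l x x'.
  move=> Kx Kx' e; exists (z l x), (z l x'); split; [exact: zP|exact: zP|].
  apply: (@conn_trans _ (y l x)); first by rewrite conn_sym; exact: y_conn.
  by rewrite e; exact: y_conn.
have mods n : n %% s < s by rewrite ltn_mod.
pose pi x n := tnth (tau (n %/ s) (y (n %/ s).+1 x)) (Ordinal (mods n)).
have piE x l (r : 'I_s) : pi x (l * s + r) = tnth (tau l (y l.+1 x)) r.
  have lE : (l * s + r) %/ s = l by rewrite divnMDl// divn_small// addn0.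
  rewrite /pi; move: (mods _); rewrite lE => h; congr tnth; apply/val_inj => /=.
  by rewrite modnMDl modn_small.
have pi_y l x x' : K x -> K x' ->
    (forall k, k < l * s -> pi x k = pi x' k) -> y l x = y l x'.
  move=> Kx Kx'; elim: l => [|l IH] e; first exact: T0E.
  apply: tau_inj.
    rewrite !f_y//; apply: IH => k kl; apply: e; apply: leq_trans kl _.
    by rewrite leq_mul2r leqnSn orbT.
  apply: eq_from_tnth => r; rewrite -!piE; apply: e.
  by rewrite mulSn addnC ltn_add2r.
exists pi; split.
  move=> om; pose a l := [tuple om (l * s + r) | r < s].
  have next l v : {z : T (l.+1 * s) | f z = v /\ tau l z = a l}.
    by apply: cid; have [z1 fz tz] := tau_surj l v (a l); exists z1.
  have /fintype1[root _] := T0.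
  pose t := fix t l : T (l * s) :=
    if l is l'.+1 then sval (next l' (t l')) else root.
  have ft l : f (t l.+1) = t l by have [] := svalP (next l (t l)).
  have taut l : tau l (t l.+1) = a l by have [] := svalP (next l (t l)).
  have t_up l : conn (t l) (up (t l.+1)).
    by have := f_up (t l.+1); rewrite ft.
  have [x Kx xt] := mem_limit t_up.
  have yt l : y l x = t l.
    have [v tv xv] := xt l.+1; rewrite -(ft l); apply: f_conn.
    by rewrite conn_sym; apply: conn_trans tv _; exact: mem_conn Kx xv (zP _ _ Kx).
  exists x => //; apply/funext => n; rewrite /pi yt taut tnth_mktuple /=.
  by rewrite -divn_eq.
move=> x x' Kx Kx'; have [piE'|] := pselect (pi x = pi x').
  by left => l; apply: y_same => //; apply: pi_y => // k _; rewrite piE'.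
move=> neq; right.
have exn : exists n, pi x n != pi x' n.
  apply: contrapT => /forallNP h; apply: neq; apply/funext => n.
  by have /negP := h n; rewrite negbK => /eqP.
pose n := ex_minn exn; have nP : pi x n != pi x' n by rewrite /n; case: ex_minnP.
have nmin k : k < n -> pi x k = pi x' k.
  rewrite /n; case: ex_minnP => n' _ n'min kn'; apply/eqP.
  by apply: contraTT kn' => /n'min; rewrite -leqNgt.
exists n; split => //; first exact/eqP.
  apply: y_same => //; apply: pi_y => // k kn; apply: nmin.
  by apply: leq_trans kn _; exact: leq_trunc_div.
move=> /(same_y _ _ _ Kx Kx') e; move: nP; apply/negP; rewrite negbK.
by rewrite /pi e.
Qed.

End Ends.

Local Open Scope classical_set_scope.
Local Open Scope card_scope.
Local Open Scope ring_scope.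

(** * The component tree of an iterated function system *)

Lemma card_of_image (X : finType) (Y : Type) (g : X -> Y) (P : pred X)
    (S : set Y) n :
  {in P &, injective g} -> (forall y, S y <-> exists2 x, P x & g x = y) ->
  S #= `I_n -> #|P| = n.
Proof.
move=> gI SP Sn; pose h (k : 'I_#|P|) := g (enum_val k).
have hI : set_inj [set: 'I_#|P|] h.
  move=> k l _ _ /gI e; apply: enum_val_inj; apply: e; exact: enum_valP.
have SE : S = h @` [set: 'I_#|P|].
  apply/seteqP; split => y.
    move=> /SP[x Px <-]; exists (enum_rank_in Px x) => //.
    by rewrite /h enum_rankK_in.
  by move=> [k _ <-]; apply/SP; exists (enum_val k) => //; exact: enum_valP.
apply/card_eq_II; apply: card_eq_trans card_II _; apply: card_eq_trans Sn.
by rewrite card_eq_sym SE inj_card_eq.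
Qed.

Section IFS.
Context {R : realType} {d m : nat}.
Local Notation V := 'cV[R]_d.+1.
Local Notation word := (seq 'I_m).
Variables (B : 'M[R]_d.+1) (D : 'I_m -> V) (w : V -> R) (K J : set V).
Hypotheses (eB : expanding B) (saK : self_affine_set B D K)
  (invJ : invariant_set B D J).
Local Notation S u := (ifs_word B D u).
Local Notation linked := (clos_refl_trans _ (hedge B D J)).

Lemma ifs_word_rcons u i x : S (rcons u i) x = S u (ifs B D i x).
Proof. by rewrite /ifs_word foldr_rcons. Qed.

Lemma ifs_wordB u x y : S u x - S u y = B ^- size u *m (x - y).
Proof.
elim: u => [|i u IH] /=; first by rewrite expr0 invr1 mul1mx.
rewrite /ifs -mulmxBr opprD addrACA subrr addr0 IH mulmxA.
by rewrite exprSr invrM ?unitrX ?expanding_unit.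
Qed.

Lemma ifs_word_continuous u : continuous (S u : V -> V).
Proof.
elim: u => [|i u IH] x; first exact: cvg_id.
by apply: continuous_comp (IH x) _; exact: affine_continuous.
Qed.

Lemma image_ifs_rcons_sub (A : set V) u i : (forall i, ifs B D i @` A `<=` A) ->
  S (rcons u i) @` A `<=` S u @` A.
Proof.
move=> iA _ [x Ax <-]; exists (ifs B D i x); last by rewrite ifs_word_rcons.
by apply: (iA i); exists x.
Qed.

Lemma K_invariant i : ifs B D i @` K `<=` K.
Proof. by have [_ _ {2}->] := saK => x [y Ky <-]; exists i => //; exists y. Qed.

Lemma J_invariant i : ifs B D i @` J `<=` J.
Proof. by have [_ _ _] := invJ; exact. Qed.

Lemma image_ifs_sub (A : set V) u : (forall i, ifs B D i @` A `<=` A) ->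
  S u @` A `<=` A.
Proof.
move=> iA; elim/last_ind: u => [|u i IH]; first by move=> _ [x Ax <-].
exact: subset_trans (image_ifs_rcons_sub iA) IH.
Qed.

Lemma K_cover n x : K x -> exists2 u : word, size u = n & (S u @` K) x.
Proof.
elim: n x => [|n IH] x Kx; first by exists [::] => //; exists x.
have : (\bigcup_i (ifs B D i @` K)) x by have [_ _ <-] := saK.
move=> [i _ [y Ky <-]]; have [u un [z Kz <-]] := IH y Ky.
by exists (i :: u); [rewrite /= un|exists z].
Qed.

Lemma KJ_bounded : exists2 M : R, 0 < M &
  (forall x, K x -> `|x| <= M) /\ (forall x, J x -> `|x| <= M).
Proof.
have [_ cK _] := saK; have [_ bJ _ _] := invJ.
have [M M0 KM] := bounded_set_norm (compact_bounded cK).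
have [M' M'0 JM] := bounded_set_norm bJ.
exists (M + M'); first exact: addr_gt0.
by split => x Ax; [apply: le_trans (KM x Ax) _|apply: le_trans (JM x Ax) _];
  rewrite ?lerDl ?lerDr ltW.
Qed.

(** [K] is the smallest closed invariant set: a point of [K] is approximated by
    images of points of [J] under longer and longer words. *)
Lemma K_sub_J : K `<=` J.
Proof.
move=> x Kx; have [[j Jj] _ clJ _] := invJ; apply: clJ.
have [M M0 [KM JM]] := KJ_bounded.
have [c [rho [c0 /andP[rho0 rho1] cP]]] := expanding_contraction eB.
have cv : c * (2 * M) * rho ^+ n @[n --> \oo] --> 0.
  rewrite -[X in _ --> X](mulr0 (c * (2 * M))).
  by apply: cvgMr; apply: cvg_expr; rewrite ger0_norm// ltW.
move=> U /nbhs_ballP[e /= e0 xU].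
have /cvgrPdist_lt /(_ e e0) [n _ /(_ n (leqnn n)) /=] := cv.
rewrite sub0r normrN => ne; have [u un [k Kk xk]] := K_cover n Kx.
exists (S u j); split; first by apply: (image_ifs_sub (u := u) J_invariant); exists j.
apply: xU; rewrite -ball_normE /ball_ /= -xk ifs_wordB un.
apply: le_lt_trans (cP _ _) _; apply: le_lt_trans ne.
apply: le_trans (ler_norm _); rewrite [leRHS]mulrAC.
rewrite ler_wpM2l//; first by rewrite mulr_ge0 ?exprn_ge0// ltW.
have := ler_normB k j; have := KM _ Kk; have := JM _ Jj; lra.
Qed.

Lemma hedge_sym u v : hedge B D J u v -> hedge B D J v u.
Proof. by move=> [uv suv [x [ux vx]]]; split; [exact/nesym|exact/esym|exists x]. Qed.

Lemma linked_sym u v : linked u v -> linked v u.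
Proof.
elim=> [x y /hedge_sym|x|x y z _ yx _ zy]; first exact: rt_step.
  exact: rt_refl.
exact: rt_trans zy yx.
Qed.

Lemma linked_size u v : linked u v -> size u = size v.
Proof. by elim=> [x y []|//|x y z _ -> _ ->]. Qed.

Lemma common_point_linked u v x : size u = size v ->
  (S u @` J) x -> (S v @` J) x -> linked u v.
Proof.
move=> suv ux vx; have [->|/eqP uv] := eqVneq u v; first exact: rt_refl.
by apply: rt_step; split => //; exists x.
Qed.

Lemma linked_rcons u v i j : linked (rcons u i) (rcons v j) -> linked u v.
Proof.
move=> uv; pose front (z : word) := take (size z).-1 z.
have frontE z k : front (rcons z k) = z by rewrite /front size_rcons -cats1 take_size_cat.
rewrite -(frontE u i) -(frontE v j); elim: uv => [x y|x|x y z _ + _].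
- case/lastP: x => [|x k]; case/lastP: y => [|y l] [_ + [t [xt yt]]];
    rewrite ?size_rcons//; first by move=> _; exact: rt_refl.
  move=> [sxy]; rewrite !frontE.
  apply: (common_point_linked (x := t)) => //.
    exact: image_ifs_rcons_sub J_invariant _ xt.
  exact: image_ifs_rcons_sub J_invariant _ yt.
- exact: rt_refl.
- exact: rt_trans.
Qed.

Definition comp (u : word) : set word := [set v | linked u v].

Lemma linked_comp u v : linked u v -> comp u = comp v.
Proof.
move=> uv; apply/seteqP; split => x; rewrite /comp /=; last exact: rt_trans.
by apply: rt_trans; exact: linked_sym.
Qed.

Lemma take_size_pf n (z : n.+1.-tuple 'I_m) : size (take n z) == n.
Proof. by rewrite size_takel// size_tuple. Qed.

Definition front n (z : n.+1.-tuple 'I_m) : n.-tuple 'I_m := Tuple (take_size_pf z).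

Definition conn n : rel (n.-tuple 'I_m) := fun u v => `[< linked u v >].

Lemma front_rcons n (z : n.+1.-tuple 'I_m) :
  tval z = rcons (front z) (tnth z ord_max).
Proof.
rewrite (tnth_nth (tnth z ord_max)) /= -[in LHS](take_size (tval z)) size_tuple.
by rewrite (take_nth (tnth z ord_max)) ?size_tuple.
Qed.

Lemma conn_sym n : symmetric (@conn n).
Proof. by move=> u v; apply/asboolP/asboolP; exact: linked_sym. Qed.

Lemma conn_refl n : reflexive (@conn n).
Proof. by move=> u; apply/asboolP; exact: rt_refl. Qed.

Lemma conn_trans n : transitive (@conn n).
Proof. by move=> v u t /asboolP uv /asboolP vt; apply/asboolP; exact: rt_trans vt. Qed.

Lemma conn_front n (z z' : n.+1.-tuple 'I_m) :
  conn z z' -> conn (front z) (front z').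
Proof.
move=> /asboolP zz'; apply/asboolP; move: zz'.
by rewrite {1}(front_rcons z) {1}(front_rcons z'); exact: linked_rcons.
Qed.

Lemma comp_tuple n (u : n.-tuple 'I_m) (v : word) :
  comp u v -> exists2 t : n.-tuple 'I_m, conn u t & tval t = v.
Proof.
move=> uv; have sv : size v == n by rewrite -(linked_size uv) size_tuple.
by exists (Tuple sv) => //; apply/asboolP.
Qed.

Section Tree.
Variables (kappa : nat) (cls : set word -> 'I_kappa)
  (A : 'M[nat]_kappa) (b : 'cV[nat]_kappa).
Hypotheses (clsP : class_enumeration B D J cls) (AP : incidence_matrix B D J cls A)
  (bP : class_sizes B D J cls b).

Definition kind n (u : n.-tuple 'I_m) : 'I_kappa := cls (comp u).

Lemma card_conn n (u : n.-tuple 'I_m) : #|conn u| = b (kind u) ord0.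
Proof.
apply: (card_of_image (g := val) (S := comp u)).
- by move=> x y _ _; exact: val_inj.
- move=> v; split => [/comp_tuple[t ut <-]|[t /asboolP ut <-]//].
  by exists t.
- by apply: bP; exists u.
Qed.

Lemma kind_conn n (u v : n.-tuple 'I_m) : conn u v -> kind u = kind v.
Proof. by move=> /asboolP /linked_comp; rewrite /kind => ->. Qed.

Lemma b_gt0 i : (0 < b i ord0)%N.
Proof.
have [_ /(_ i)[T [u ->] <-]] := clsP.
pose t : (size u).-tuple 'I_m := in_tuple u.
by rewrite -[cls _]/(kind t) -card_conn; apply/card_gt0P; exists t; exact: conn_refl.
Qed.

Lemma offspring_compP n (u : n.-tuple 'I_m) (z : n.+1.-tuple 'I_m) :
  offspring (comp u) z <-> conn u (front z).
Proof.
split=> [[v [i [uv zE]]]|/asboolP uz].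
  apply/asboolP; suff -> : val (front z) = v by [].
  by rewrite /= zE -cats1 take_size_cat// -(linked_size uv) size_tuple.
by exists (front z), (tnth z ord_max); split => //; exact: front_rcons.
Qed.

Lemma card_components_below n (u : n.-tuple 'I_m) j :
  #|[pred z : n.+1.-tuple 'I_m |
     [&& conn u (front z), rep (@conn _) z == z & kind z == j]]| = A (kind u) j.
Proof.
have compT : hcomponent B D J (comp u) by exists u.
apply: (card_of_image (g := fun z : n.+1.-tuple 'I_m => comp z)); last exact: AP.
  move=> z z'; rewrite !inE => /and3P[_ /eqP rz _] /and3P[_ /eqP rz' _] e.
  have zz' : conn z z'.
    by apply/asboolP; have : comp z' z' := rt_refl _ _ _; rewrite -e.
  by rewrite -rz -rz'; apply: equiv_rep_eq zz';
    [exact: conn_refl|exact: conn_sym|exact: conn_trans].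
move=> Z; split => [[[v ->] sub clsv]|[z /and3P[uz _ /eqP kz] <-]]; last first.
  split => //; first by exists z.
  move=> v /comp_tuple[t zt <-]; apply/offspring_compP.
  by apply: conn_trans uz _; exact: conn_front.
have := sub v (rt_refl _ _ _); move=> [v' [i [uv' vE]]].
have sv : size v == n.+1 by rewrite vE size_rcons -(linked_size uv') size_tuple.
pose z := Tuple sv; exists (rep (@conn _) z).
  have zr : conn z (rep (@conn _) z) by apply: equiv_rep; exact: conn_refl.
  rewrite inE -(kind_conn zr) /kind clsv eqxx andbT.
  rewrite -(equiv_rep_eq (@conn_refl _) (@conn_sym _) (@conn_trans _) zr) eqxx andbT.
  apply: (@conn_trans _ (front z)); last exact: conn_front.
  by apply/offspring_compP; exact: sub (rt_refl _ _ _).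
apply/esym/linked_comp.
by have /asboolP := equiv_rep (@conn_refl _) z.
Qed.

Lemma ifs_component_tree :
  component_tree m A (fun i => b i ord0) (@front) (@conn) kind.
Proof.
split.
- by rewrite card_tuple.
- move=> n u; pose ext (i : 'I_m) : n.+1.-tuple 'I_m := [tuple of rcons u i].
  rewrite -[RHS](card_ord m) -(card_imset _ (f := ext)).
    apply: eq_card => z; rewrite !inE; apply/eqP/imsetP => [zu|[i _ ->]].
      by exists (tnth z ord_max) => //; apply/val_inj; rewrite /= -zu front_rcons.
    by apply/val_inj; rewrite /= -cats1 take_size_cat ?size_tuple.
  by move=> i j /(congr1 val) /= /rcons_inj[].
- exact: conn_refl.
- exact: conn_sym.
- exact: conn_trans.
- exact: conn_front.
- exact: kind_conn.
- exact: b_gt0.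
- exact: card_conn.
move=> n u j; rewrite -card_components_below.
pose P (z : n.+1.-tuple 'I_m) := conn u (front z) && (kind z == j).
have Pconn (y z : n.+1.-tuple 'I_m) : conn y z -> P y = P z.
  move=> yz; rewrite /P (kind_conn yz); congr (_ && _).
  by apply/idP/idP => h; apply: conn_trans h _; apply: conn_front; rewrite // conn_sym.
rewrite -sum1_card (eq_bigl P)//.
rewrite (sum_over_classes (@conn_refl _) (@conn_sym _) (@conn_trans _) _ Pconn).
rewrite -[X in _ = (X * _)%N]sum1_card big_distrl /=; apply: eq_big => z.
  by rewrite inE /P -andbA [in RHS]andbA [(kind _ == _) && _]andbC andbA.
move=> /andP[/andP[_ /eqP <-] _]; rewrite mul1n -card_conn -sum1_card.
exact: eq_bigl.
Qed.

Local Notation tup := (fun n => n.-tuple 'I_m).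

Lemma image_anc_sub (s n : nat) (z : (s + n).-tuple 'I_m) :
  S z @` K `<=` S (anc (T := tup) (@front) z) @` K.
Proof.
elim: s z => [z|s IH z]; first by move=> x.
apply: subset_trans (IH _).
by rewrite {1}front_rcons; exact: image_ifs_rcons_sub K_invariant.
Qed.

(** A horizontal edge moves by a bounded amount after rescaling by [B ^ n], and
    a component is crossed in fewer steps than it has words. *)
Lemma conn_gap (M : R) n (u v : n.-tuple 'I_m) : (forall x, J x -> `|x| <= M) ->
  conn u v -> `|B ^+ n *m (S u 0 - S v 0)| <= 2 * M * (b (kind u) ord0)%:R.
Proof.
move=> JM uv; pose e : rel (n.-tuple 'I_m) := fun x y => `[< hedge B D J x y >].
have [[j Jj] _ _ _] := invJ; have M0 : 0 <= M := le_trans (normr_ge0 _) (JM _ Jj).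
have edge (x y : n.-tuple 'I_m) : e x y -> `|B ^+ n *m (S x 0 - S y 0)| <= 2 * M.
  move=> /asboolP[_ _ [t [[k Jk kt] [l Jl lt]]]].
  have -> : S x 0 - S y 0 = (S y l - S y 0) - (S x k - S x 0).
    by rewrite kt lt opprB [RHS]addrC addrA subrK.
  rewrite !ifs_wordB !size_tuple !subr0 -mulmxBr mulmx_powVK//.
  by have := ler_normB l k; have := JM _ Jk; have := JM _ Jl; lra.
have bound x p : path e x p ->
    `|B ^+ n *m (S x 0 - S (last x p) 0)| <= 2 * M * (size p)%:R.
  elim: p x => [|y p IH] x /=; first by rewrite subrr mulmx0 normr0 mulr0.
  move=> /andP[/edge xy /IH yp].
  have -> : S x 0 - S (last y p) 0 = (S x 0 - S y 0) + (S y 0 - S (last y p) 0).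
    by rewrite addrA subrK.
  rewrite mulmxDr (le_trans (ler_normD _ _))// -natr1; lra.
have cuv : connect e u v.
  have link (x y : word) : linked x y -> forall (sx : size x == n) (sy : size y == n),
      connect e (Tuple sx) (Tuple sy).
    elim=> [x' y' h|x'|x' y' z' xy IH1 yz IH2] sx sy.
    - by apply: connect1; apply/asboolP.
    - by rewrite (bool_irrelevance sx sy); exact: connect0.
    have sy' : size y' == n by rewrite -(linked_size xy).
    exact: connect_trans (IH1 sx sy') (IH2 sy' sy).
  have /asboolP uv' := uv; have := link _ _ uv' (valP u) (valP v).
  by rewrite (_ : Tuple (valP u) = u) 1?(_ : Tuple (valP v) = v)//; exact/val_inj.
have /connectP[p pu ->] := cuv; case: (shortenP pu) => q qu uq _.
apply: le_trans (bound _ _ qu) _; rewrite ler_wpM2l ?mulr_ge0// ler_nat.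
rewrite -card_conn; apply: leq_trans (_ : (size (u :: q) <= _)%N); first by [].
have /card_uniqP <- := uq; apply: subset_leq_card; apply/fintype.subsetP => x.
have path_conn y p' : path e y p' -> x \in y :: p' -> conn y x.
  elim: p' y => [|y' p' IH] y /=; first by rewrite inE => _ /eqP ->; exact: conn_refl.
  move=> /andP[/asboolP yy' p'P]; rewrite inE => /orP[/eqP ->|/(IH _ p'P)].
    exact: conn_refl.
  by apply: conn_trans; apply/asboolP; exact: rt_step.
exact: path_conn.
Qed.

(** The unions of the pieces of the nested components form a decreasing sequence
    of nonempty compact sets. *)
Lemma nested_components s (t : forall l, (l * s).-tuple 'I_m) :
  (forall l, conn (t l) (anc (T := tup) (@front) (s := s) (t l.+1))) ->
  exists2 x, K x & forall l, exists2 v : (l * s).-tuple 'I_m,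
    conn (t l) v & (S v @` K) x.
Proof.
move=> tP; have [[k Kk] cK _] := saK.
pose F l := \bigcup_(v in [set v | conn (t l) v]) (S v @` K).
have clF l : closed (F l).
  apply: closed_bigcup; first exact: finite_finset.
  move=> v _; apply: compact_closed; first exact: norm_hausdorff.
  by apply: continuous_compact cK; apply: continuous_subspaceT; exact: ifs_word_continuous.
have Fdec l : F l.+1 `<=` F l.
  move=> x [v tv vx]; exists (anc (T := tup) (@front) (s := s) v).
    apply: conn_trans (tP l) _; apply: (conn_anc (m := m) (A := A)) => //.
    exact: ifs_component_tree.
  exact: image_anc_sub vx.
have Fmono l l' : (l <= l')%N -> F l' `<=` F l.
  move=> /subnK <-; elim: (l' - l)%N => [//|j IH].
  exact: subset_trans (Fdec _) IH.
have FK l : F l `<=` K by move=> x [v _]; exact: (image_ifs_sub (u := v) K_invariant).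
pose x l := S (t l) k.
have xF l : F l (x l) by exists (t l); [exact: conn_refl|exists k].
have [y [Ky yc]] : K `&` cluster (x @ \oo) !=set0.
  by apply: (cK (x @ \oo) (fmap_proper_filter x _)); exists 0%N => // l _; exact: FK (xF l).
exists y => // l; suff [v tv vy] : F l y by exists v.
apply: clF => U yU; apply: yc => //.
by exists l => // l' /= /Fmono; apply; exact: xF.
Qed.

(** Points in the same component at level [n] satisfy [w (x - y) <= C scale B n]
    by [conn_gap], and points in different components satisfy the reverse
    inequality by condition (H_w). The addresses of [ends_coding] are blocks of
    [s] letters and lag behind the components by at most two blocks, which costs
    the factors [scale B (- s)] and [scale B (2 * s)]. *)
Theorem ifs_coded : gauge B w -> condition_Hw B D w K ->
  rearrangeable m b A \/ primitive A -> coded m (scale B) w K.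
Proof.
move=> gw [c c0 HwP] AP'; have [[k Kk] cK _] := saK.
have tree := ifs_component_tree.
have m0 : (0 < m)%N.
  by have [u + _] := K_cover 1 Kk; case: u => // i; rewrite (leq_ltn_trans _ (ltn_ord i)).
have [s [s0 regr]] : exists s, (0 < s)%N /\ forall n,
    exists f : (s + n).-tuple 'I_m -> n.-tuple 'I_m,
      regrouping m (T := tup) (@front) (@conn) f.
  case: AP' => [rA|pA].
    exists 1%N; split => // n.
    exact: (rearrangeable_regrouping tree) rA.
  apply: (primitive_regrouping tree) => //.
  exists (kind [tuple]); apply/eqP; rewrite eqn_leq b_gt0 andbT -card_conn.
  by rewrite -(tree_root tree) max_card.
pose f l := sval (cid (regr (l * s)%N)).
have fP l : regrouping m (T := tup) (@front) (@conn) (f l) := svalP (cid (regr _)).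
pose up l := anc (T := tup) (@front) (s := s) (n := (l * s)%N).
pose mem l x (u : (l * s).-tuple 'I_m) := (S u @` K) x.
have mem_ex l x : K x -> exists u, mem l x u.
  move=> Kx; have [u /eqP su ux] := K_cover (l * s)%N Kx.
  by exists (Tuple su).
have mem_conn l x (u v : (l * s).-tuple 'I_m) : K x -> mem l x u -> mem l x v -> conn u v.
  move=> _ xu xv; apply/asboolP; apply: (common_point_linked (x := x)).
  - by rewrite !size_tuple.
  - exact: image_subset K_sub_J _ xu.
  - exact: image_subset K_sub_J _ xv.
have f_conn l z z' : conn z z' -> f l z = f l z' by have [h _ _] := fP l; exact: h.
have f_up l z : conn (f l z) (up l z) by have [_ h _] := fP l; exact: h.
have f_card l v : #|[pred z | f l z == v]| = (m ^ s)%N by have [_ _ h] := fP l; exact: h.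
have [pi [pi_surj piP]] := ends_coding m0 s0 (tree_root tree) (@conn_sym) (@conn_trans)
  f_conn f_up f_card mem_ex (fun l x z _ => @image_anc_sub s (l * s) z x) mem_conn
  (@nested_components s).
have [M M0 [KM JM]] := KJ_bounded.
have [bmax bmaxP] : exists bmax, forall i, (b i ord0 <= bmax)%N.
  by exists (\max_i b i ord0)%N => i; exact: leq_bigmax.
pose Delta := 2 * M * bmax%:R + 2 * M.
have same_gap l x y : same_component (@conn) mem l x y ->
    `|B ^+ (l * s) *m (x - y)| <= Delta.
  move=> [u [v [[i Ki ux] [j Kj vy] uv]]]; rewrite -{x}ux -{y}vy.
  have -> : S u i - S v j = (S u i - S u 0) - (S v j - S v 0) + (S u 0 - S v 0).
    rewrite opprB -addrA [X in _ = _ + X]addrC [X in _ = _ + X]addrA subrK.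
    by rewrite addrA subrK.
  rewrite mulmxDr !ifs_wordB !size_tuple -mulmxBr mulmx_powVK// !subr0.
  have gap : `|B ^+ (l * s) *m (S u 0 - S v 0)| <= 2 * M * bmax%:R.
    apply: le_trans (conn_gap JM uv) _.
    by rewrite ler_wpM2l ?mulr_ge0 ?(ltW M0)// ler_nat.
  have := ler_normD (i - j) (B ^+ (l * s) *m (S u 0 - S v 0)).
  have := ler_normB i j; have := KM _ Ki; have := KM _ Kj; rewrite /Delta; lra.
have [w0 wge0 wB wbounded] := gw; have [C C0 CP] := wbounded Delta.
have upper l x y : same_component (@conn) mem l x y -> w (x - y) <= scale B (l * s)%N * C.
  move=> /same_gap gap; rewrite -(mulmx_powK eB (l * s) (x - y)) exprnN wB opprK.
  by rewrite ler_pM2l ?scale_gt0// CP.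
have lower l x y : K x -> K y -> (0 < l)%N -> ~ same_component (@conn) mem l x y ->
    c * scale B (l * s)%N <= w (x - y).
  move=> Kx Ky l0 nsame; have [u ux] := mem_ex l x Kx; have [v vy] := mem_ex l y Ky.
  have uv0 : (S u @` K) `&` (S v @` K) = set0.
    apply/seteqP; split => // z [zu zv]; apply: nsame; exists u, v; split => //.
    by apply: (mem_conn l z) => //; exact: (image_ifs_sub (u := u) K_invariant).
  have ls0 : (1 <= l * s)%N by rewrite muln_gt0 l0.
  apply: le_trans (HwP _ _ _ ls0 (size_tuple u) (size_tuple v) uv0) _.
  apply: ge_inf; last by exists x => //; exists y.
  by exists 0 => _ [x' _ [y' _ <-]]; exact: wge0.
have scale_anti (i j : int) : i <= j -> scale B j <= scale B i.
  move=> ij; have -> : i = j + - (absz (j - i))%:Z by rewrite gez0_abs ?subr_ge0//; lia.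
  by rewrite scaleD// ler_peMr ?scale_ge1// ltW ?scale_gt0.
have separated x y : x <> y -> ~ forall l, same_component (@conn) mem l x y.
  move=> xy allsame; apply: xy; apply/eqP; rewrite -subr_eq0 -normr_le0.
  have [cB [rho [cB0 /andP[rho0 rho1] BP]]] := expanding_contraction eB.
  have cv : cB * Delta * rho ^+ l @[l --> \oo] --> 0.
    rewrite -[X in _ --> X](mulr0 (cB * Delta)).
    by apply: cvgMr; apply: cvg_expr; rewrite ger0_norm// ltW.
  apply: (ler_cvg_to (cvg_cst _) cv); apply: nearW => l.
  rewrite -(mulmx_powK eB (l * s) (x - y)) (le_trans (BP _ _))// mulrAC.
  apply: ler_pM.
  - by rewrite mulr_ge0// ltW.
  - by rewrite exprn_ge0// ltW.
  - by rewrite ler_pM2l// same_gap.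
  - by apply: ler_wiXn2l; [exact: ltW|exact: ltW|exact: leq_pmulr].
exists pi, (c * scale B (2 * s)%N), (C * scale B (- s%:Z)); split => //.
- by rewrite mulr_gt0 ?scale_gt0.
- by rewrite mulr_gt0 ?scale_gt0.
move=> x y Kx Ky xy; case: (piP x y Kx Ky) => [/(separated _ _ xy) //|].
move=> [n [agree differ samel nsame]]; exists n; first by split.
have nE := divn_eq n s; have ns := ltn_pmod n s0.
apply/andP; split.
  apply: le_trans (lower _ _ _ Kx Ky _ nsame) => //.
  rewrite -mulrA -scaleD// ler_pM2l// scale_anti//.
  by move: nE ns; set l := (n %/ s)%N; set r := (n %% s)%N => -> rs; lia.
apply: le_trans (upper _ _ _ samel) _; rewrite mulrC -mulrA -scaleD// ler_pM2l// scale_anti//.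
by move: nE ns; set l := (n %/ s)%N; set r := (n %% s)%N => -> rs; lia.
Qed.

End Tree.

End IFS.

(** * A dust-like Cantor set on a coordinate axis *)

Section Cantor.
Context {R : realType} {m : nat}.
Variable lam : R.
Hypotheses (m0 : (0 < m)%N) (lamm : m%:R < lam).
Implicit Types om : nat -> 'I_m.

Let lam0 : 0 < lam. Proof. exact: le_lt_trans lamm. Qed.

Let lam1 : 1 < lam. Proof. by apply: le_lt_trans lamm; rewrite ler1n. Qed.

Definition cantor_term om : R^nat := fun k => (om k)%:R / lam ^+ k.+1.

Definition cantor_point om : R := limn (series (cantor_term om)).

Definition shift (T : Type) (om : nat -> T) : nat -> T := fun k => om k.+1.

(** The diameter of the Cantor set. *)
Definition cantor_diam : R := (m%:R - 1) / (lam - 1).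

Lemma cantor_diam_ge0 : 0 <= cantor_diam.
Proof. by rewrite divr_ge0// subr_ge0 ?ler1n// ltW. Qed.

Lemma cantor_diam_lt1 : cantor_diam < 1.
Proof. by rewrite ltr_pdivrMr ?subr_gt0// mul1r ltrD2r. Qed.

Lemma letter_le om k : (om k)%:R <= m%:R - 1 :> R.
Proof. by rewrite lerBrDr natr1 ler_nat. Qed.

Lemma cantor_term_ge0 om k : 0 <= cantor_term om k.
Proof. by rewrite divr_ge0// exprn_ge0// ltW. Qed.

Lemma cantor_series_shift om n : series (cantor_term om) n.+1 =
  ((om 0%N)%:R + series (cantor_term (shift om)) n) / lam.
Proof.
rewrite /series /= big_nat_recl// mulrDl {1}/cantor_term expr1; congr (_ + _).
rewrite mulr_suml; apply: eq_bigr => k _.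
by rewrite /cantor_term /shift [lam ^+ k.+2]exprSr invfM mulrA.
Qed.

Lemma cantor_series_le om n : series (cantor_term om) n <= cantor_diam.
Proof.
elim: n om => [|n IH] om.
  by rewrite /series /= big_geq// cantor_diam_ge0.
rewrite cantor_series_shift ler_pdivrMr//.
have := IH (shift om); have := letter_le om 0.
have : cantor_diam * lam = (m%:R - 1) + cantor_diam.
  rewrite /cantor_diam; field.
  by rewrite subr_eq0 gt_eqF.
lra.
Qed.

Lemma is_cvg_cantor om : cvgn (series (cantor_term om)).
Proof.
apply: nondecreasing_is_cvgn.
  by apply: nondecreasing_series => k _ _; exact: cantor_term_ge0.
by exists cantor_diam => _ [n _ <-]; exact: cantor_series_le.
Qed.

Lemma cantor_point_ge0 om : 0 <= cantor_point om.
Proof.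
rewrite /cantor_point; apply: limr_ge; first exact: is_cvg_cantor.
apply: nearW => n.
by apply: sumr_ge0 => k _; exact: cantor_term_ge0.
Qed.

Lemma cantor_point_le om : cantor_point om <= cantor_diam.
Proof.
rewrite /cantor_point; apply: limr_le; first exact: is_cvg_cantor.
by apply: nearW => n; exact: cantor_series_le.
Qed.

Lemma cantor_point_shift om :
  cantor_point om = ((om 0%N)%:R + cantor_point (shift om)) / lam.
Proof.
have h : [sequence series (cantor_term om) n.+1]_n @ \oo --> cantor_point om.
  by rewrite cvg_shiftS; exact: is_cvg_cantor.
apply: (cvg_unique (@Rhausdorff R) h).
rewrite (_ : [sequence _]_n = fun n =>
    ((om 0%N)%:R + series (cantor_term (shift om)) n) / lam); last first.
  by apply/funext => n; exact: cantor_series_shift.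
by apply: cvgMl; apply: cvgD; [exact: cvg_cst|exact: is_cvg_cantor].
Qed.

Lemma cantor_pointB om om' :
  `|cantor_point om - cantor_point om'| <= cantor_diam.
Proof.
have := cantor_point_ge0 om; have := cantor_point_ge0 om'.
have := cantor_point_le om; have := cantor_point_le om'.
by rewrite ler_norml => *; apply/andP; split; lra.
Qed.

(** Scaling by [lam ^ n] removes the common letters; the first letters that
    differ then contribute at least [1 / lam] to the difference and the rest at
    most [cantor_diam / lam], where [cantor_diam < 1] because [m < lam]. *)
Lemma cantor_distance om om' n : first_diff om om' n ->
  (1 - cantor_diam) / lam <=
    `|cantor_point om - cantor_point om'| * lam ^+ n <= cantor_diam.
Proof.
elim: n om om' => [|n IH] om om' [agree differ].
  rewrite expr0 mulr1 cantor_pointB andbT.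
  rewrite (cantor_point_shift om) (cantor_point_shift om') -mulrBl normrM.
  rewrite [`|lam^-1|]gtr0_norm ?invr_gt0// ler_pM2r ?invr_gt0//.
  rewrite opprD addrACA.
  have : 1 <= `|(om 0%N)%:R - (om' 0%N)%:R : R|.
    have : val (om 0%N) != val (om' 0%N) by apply/eqP => /val_inj.
    rewrite neq_ltn => /orP[lt|lt]; [rewrite distrC|];
      by rewrite -natrB ?(ltnW lt)// ger0_norm// ler1n subn_gt0.
  have := cantor_pointB (shift om) (shift om').
  set x := _ - _; set y := _ - _; have := lerB_normD y x; lra.
have fd : first_diff (shift om) (shift om') n.
  by split => // k kn; exact: agree.
have := IH _ _ fd; suff -> :
    `|cantor_point om - cantor_point om'| * lam ^+ n.+1 =
    `|cantor_point (shift om) - cantor_point (shift om')| * lam ^+ n by [].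
rewrite (cantor_point_shift om) (cantor_point_shift om') (agree 0%N)//.
rewrite -mulrBl opprD addrACA subrr add0r normrM exprS mulrA; congr (_ * _).
by rewrite [`|lam^-1|]gtr0_norm ?invr_gt0// divfK// gt_eqF.
Qed.

Lemma first_diff_exists (om om' : nat -> 'I_m) : om <> om' -> exists n, first_diff om om' n.
Proof.
move=> neq; have exn : exists n, om n != om' n.
  apply: contrapT => /forallNP h; apply: neq; apply/funext => n.
  by have /negP := h n; rewrite negbK => /eqP.
exists (ex_minn exn); case: ex_minnP => n /eqP nP nmin; split => // k kn.
by apply/eqP; apply: contraTT kn => /nmin; rewrite -leqNgt.
Qed.

Let gap : R := (1 - cantor_diam) / lam.

Let gap_gt0 : 0 < gap.
Proof. by rewrite divr_gt0// subr_gt0 cantor_diam_lt1. Qed.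

Lemma cantor_close om om' k :
  `|cantor_point om - cantor_point om'| * lam ^+ k < gap ->
  forall j, (j <= k)%N -> om j = om' j.
Proof.
move=> close j jk; apply: contrapT => neq.
have [n fd] := @first_diff_exists om om' (fun e => neq (congr1 (@^~ j) e)).
have nj : (n <= j)%N by rewrite leqNgt; apply/negP => /(proj1 fd).
have /andP[+ _] := cantor_distance fd; rewrite leNgt => /negP; apply.
apply: le_lt_trans close; rewrite ler_wpM2l// ler_weXn2l ?(ltW lam1)//.
exact: leq_trans jk.
Qed.

(** A limit of points of the Cantor set is the point whose letters are the
    eventual letters of the approximating addresses. *)
Lemma closed_cantor : closed (range (cantor_point : (nat -> 'I_m) -> R)).
Proof.
move=> t tcl.
have near_t n : exists om, `|cantor_point om - t| * lam ^+ n < gap / 2.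
  have e0 : 0 < gap / 2 / lam ^+ n by apply: divr_gt0; [exact: divr_gt0|exact: exprn_gt0].
  have /(_ (ball t (gap / 2 / lam ^+ n))) := tcl.
  move=> /(_ (nbhsx_ballx t _ e0))[_ [[om _ <-]]] om_t.
  by exists om; rewrite -ltr_pdivlMr ?exprn_gt0// distrC.
have [a aP] := choice near_t.
have lam_ge0 k : 0 <= lam ^+ k by rewrite exprn_ge0// ltW.
have agree i j : (i <= j)%N -> a i i = a j i.
  move=> ij; apply: (@cantor_close _ _ i) => //.
  have h1 := aP i; have h2 : `|cantor_point (a j) - t| * lam ^+ i < gap / 2.
    apply: le_lt_trans (aP j); rewrite ler_wpM2l// ler_weXn2l ?(ltW lam1)//.
  have : `|cantor_point (a i) - cantor_point (a j)| * lam ^+ i <=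
      (`|cantor_point (a i) - t| + `|cantor_point (a j) - t|) * lam ^+ i.
    rewrite ler_wpM2r// -[X in `|X|](subrKA t) [X in _ <= _ + X]distrC.
    exact: ler_normD.
  lra.
pose om k := a k k; exists om => //.
have bound j : `|cantor_point om - t| <= (cantor_diam + gap) * lam^-1 ^+ j.
  have h1 : `|cantor_point om - cantor_point (a j)| * lam ^+ j <= cantor_diam.
    have [->|neq] := pselect (om = a j).
      by rewrite subrr normr0 mul0r cantor_diam_ge0.
    have [n fd] := first_diff_exists neq.
    have jn : (j <= n)%N.
      by rewrite leqNgt; apply/negP => nj; have [_] := fd; apply; exact: agree (ltnW nj).
    have /andP[_] := cantor_distance fd; apply: le_trans.
    by rewrite ler_wpM2l// ler_weXn2l ?(ltW lam1).
  have h2 := aP j; rewrite exprVn ler_pdivlMr ?exprn_gt0//.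
  have : `|cantor_point om - t| * lam ^+ j <=
      (`|cantor_point om - cantor_point (a j)| + `|cantor_point (a j) - t|) * lam ^+ j.
    rewrite ler_wpM2r// -[X in `|X|](subrKA (cantor_point (a j))).
    exact: ler_normD.
  have := gap_gt0; lra.
apply/eqP; rewrite -subr_eq0 -normr_le0.
have cv : (cantor_diam + gap) * lam^-1 ^+ j @[j --> \oo] --> 0.
  rewrite -[X in _ --> X](mulr0 (cantor_diam + gap)).
  apply: cvgMr; apply: cvg_expr; rewrite ger0_norm ?invr_ge0 ?(ltW lam0)//.
  by rewrite invf_lt1.
by apply: (ler_cvg_to (cvg_cst _) cv); exact: nearW.
Qed.

Lemma compact_cantor : compact (range (cantor_point : (nat -> 'I_m) -> R)).
Proof.
apply: (subclosed_compact closed_cantor (@segment_compact _ 0 cantor_diam)).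
by move=> _ [om _ <-] /=; rewrite in_itv /= cantor_point_ge0 cantor_point_le.
Qed.

End Cantor.

Section DustLike.
Context {R : realType} {d m : nat}.
Local Notation V := 'cV[R]_d.+1.
Variables (N : V -> R) (delta : R) (phi : V -> R) (q : R).
Hypotheses (nN : is_norm N) (delta_half : delta < 2^-1)
  (mphi : mollifier N delta phi) (m0 : (0 < m)%N) (mq : m%:R < q).

(** The dilation is [m mu] on the first axis and [mu] on the others, with
    [mu ^ (d + 1) = q / m], so that its determinant is [q] and the [m]
    contractions of ratio [1 / (m mu)] leave gaps on the first axis. *)
Let mu : R := (q / m%:R) `^ (d.+1%:R^-1).

Let m_gt0 : 0 < m%:R :> R. Proof. by rewrite ltr0n. Qed.

Let mu1 : 1 < mu.
Proof.
have e1 : 1 `^ (d.+1%:R^-1) = 1 :> R by rewrite powR1.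
rewrite /mu -[ltLHS]e1 gt0_ltr_powR ?invr_gt0 ?nnegrE//.
  by rewrite divr_ge0// ltW// (lt_trans _ mq).
by rewrite ltr_pdivlMr// mul1r.
Qed.

Let mu0 : 0 < mu. Proof. exact: lt_trans mu1. Qed.

Let mu_pow : m%:R * mu ^+ d.+1 = q.
Proof.
have qm0 : 0 <= q / m%:R by rewrite divr_ge0// ltW// (lt_trans _ mq).
have -> : mu ^+ d.+1 = q / m%:R.
  rewrite -(powR_mulrn _ (ltW mu0)) /mu -powRrM mulVf ?pnatr_eq0//.
  exact: powRr1.
by rewrite mulrC divfK// gt_eqF.
Qed.

Let lam : R := m%:R * mu.

Let lamm : m%:R < lam. Proof. by rewrite ltr_pMr. Qed.

Let lam1 : 1 < lam. Proof. by apply: le_lt_trans lamm; rewrite ler1n. Qed.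

Let lam0 : 0 < lam. Proof. exact: lt_trans lam1. Qed.

Let ratio : 'rV[R]_d.+1 := \row_j (if j == 0 then lam else mu).

Definition axis_matrix : 'M[R]_d.+1 := diag_mx ratio.
Let B2 := axis_matrix.

Let ratio1 j : 1 < ratio 0 j. Proof. by rewrite mxE; case: ifP. Qed.

Let B2E (x : V) i : (B2 *m x) i 0 = ratio 0 i * x i 0.
Proof. by rewrite mul_diag_mx mxE. Qed.

Lemma det_axis_matrix : \det B2 = q.
Proof.
rewrite det_diag big_ord_recl mxE eqxx -mu_pow exprS mulrA; congr (_ * _).
under eq_bigr do rewrite mxE /=.
by rewrite prodr_const card_ord.
Qed.

Lemma axis_matrix_expanding : expanding B2.
Proof.
move=> z /eigenvalueP[v vB v0].
have [j vj] : exists j, v 0 j != 0.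
  apply: contrapT => /forallNP h; move: v0; apply/negP; rewrite negbK.
  by apply/eqP/rowP => j; rewrite mxE; have /negP := h j; rewrite negbK => /eqP.
have := congr1 (fun u : 'rV_d.+1 => u 0 j) vB.
rewrite map_diag_mx mul_mx_diag !mxE mulrC => /(mulIf vj) <-.
have r1 : 1 < (if j == 0 then lam else mu) by case: ifP.
by rewrite normc_def /= expr0n addr0 sqrtr_sqr gtr0_norm ?ltcR// (lt_trans ltr01).
Qed.

Let B2_unit : B2 \is a GRing.unit.
Proof. exact/expanding_unit/axis_matrix_expanding. Qed.

Let e0 : V := delta_mx 0 0.

Let e0_le1 : `|e0| <= 1.
Proof.
apply: norm_le_entries => // i j; rewrite mxE.
by case: (_ && _); rewrite ?normr1 ?normr0.
Qed.

Let B2e0 (t : R) : B2 *m (t *: e0) = (lam * t) *: e0.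
Proof.
by apply/colP => i; rewrite B2E !mxE; case: (eqVneq i 0) => _; rewrite ?mulr1 ?mulr0.
Qed.

Let B2Ve0 (t : R) : invmx B2 *m (t *: e0) = (t / lam) *: e0.
Proof.
have -> : t *: e0 = B2 *m ((t / lam) *: e0).
  by rewrite B2e0 mulrC divfK// gt_eqF.
by rewrite mulKmx.
Qed.

Definition axis_digit (i : 'I_m) : V := (i : nat)%:R *: e0.

Let point (om : nat -> 'I_m) : V := cantor_point lam om *: e0.

Definition axis_cantor : set V := range point.
Let K2 := axis_cantor.

Let ifs_point i om : ifs B2 axis_digit i (point om) =
  point (fun k => if k is k'.+1 then om k' else i).
Proof.
rewrite /ifs /axis_digit /point -scalerDl B2Ve0; congr (_ *: _).
by rewrite [RHS](cantor_point_shift m0 lamm) addrC.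
Qed.

Lemma axis_cantor_self_affine : self_affine_set B2 axis_digit K2.
Proof.
split.
- by exists (point (fun=> Ordinal m0)); exists (fun=> Ordinal m0).
- rewrite (_ : K2 = (fun t : R => t *: e0) @` 
      range (cantor_point lam : (nat -> 'I_m) -> R)).
    apply: continuous_compact; last exact: compact_cantor m0 lamm.
    apply: continuous_subspaceT.
    apply: (@lipschitz_cst_continuous R R^o V _ 1) => // t t'.
    by rewrite -scalerBl normrZ mulrC ler_wpM2r.
  apply/seteqP; split => x.
    by move=> [om _ <-]; exists (cantor_point lam om) => //; exists om.
  by move=> [_ [om _ <-] <-]; exists om.
- apply/seteqP; split => x.
    move=> [om _ <-]; exists (om 0%N) => //; exists (point (shift om)).
      by exists (shift om).
    by rewrite ifs_point; congr point; apply/funext => -[].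
  by move=> [i _ [_ [om _ <-] <-]]; rewrite ifs_point; eexists.
Qed.

Let gap : R := (1 - cantor_diam lam (m := m)) / lam.

Let gap_gt0 : 0 < gap.
Proof. by rewrite divr_gt0// subr_gt0 cantor_diam_lt1. Qed.

Let point_inj om om' : point om = point om' -> om = om'.
Proof.
move=> e; apply: contrapT => /first_diff_exists[n fd].
have e' : cantor_point lam om = cantor_point lam om'.
  by have := congr1 (fun x : V => x 0 0) e; rewrite !mxE eqxx !mulr1.
have := cantor_distance m0 lamm fd; rewrite e' subrr normr0 mul0r => /andP[+ _].
by rewrite leNgt gap_gt0.
Qed.

Lemma axis_cantor_dust_like : dust_like B2 axis_digit K2.
Proof.
move=> i j ij; apply/seteqP; split => // x [[_ [om _ <-] <-] [_ [om' _ <-]]].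
rewrite !ifs_point => /point_inj /(congr1 (@^~ 0%N)) /= ji.
by apply: ij; rewrite ji.
Qed.

(** The mollifier [phi] is kept, and the sup norm is scaled by a constant
    [kappa] so small that the support of [phi] becomes tiny. *)
Lemma axis_gauge_constants : exists kappa delta2 : R,
  [/\ 0 < kappa, 0 < delta2 < 2^-1, delta2 <= (lam - 1) / 2,
      kappa * cantor_diam lam (m := m) < 1
    & mollifier (fun x => kappa * `|x|) delta2 phi].
Proof.
have [c c0 Nc] := sup_le_is_norm nN.
pose delta2 := Num.min 4^-1 ((lam - 1) / 2).
have diam0 := cantor_diam_ge0 m0 lamm.
pose kappa := delta2 / (c + cantor_diam lam (m := m)).
have cd0 : 0 < c + cantor_diam lam (m := m) by rewrite ltr_pwDl.
have l10 : 0 < (lam - 1) / 2 by rewrite divr_gt0// subr_gt0.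
have d20 : 0 < delta2 by rewrite lt_min l10 andbT invr_gt0.
have d24 : delta2 <= 4^-1 by rewrite ge_min lexx.
have d21 : delta2 < 2^-1 by apply: le_lt_trans d24 _; rewrite ltf_pV2 ?posrE// ltr_nat.
have kappa0 : 0 < kappa by rewrite divr_gt0.
exists kappa, delta2; split => //.
- by rewrite d20.
- by rewrite ge_min lexx orbT.
- rewrite /kappa mulrAC ltr_pdivrMr// mul1r.
  apply: (@le_lt_trans _ _ (1 * cantor_diam lam (m := m))).
    rewrite ler_wpM2r// (le_trans d24)// invf_le1// ler1n//.
  by rewrite mul1r ltrDr.
- have [sm p0 supp pN p1] := mphi; split => // x /supp; rewrite /nball /= => Nx.
  have x1 : `|x| < c.
    apply: le_lt_trans (Nc x) _; rewrite -[ltRHS]mulr1 ltr_pM2l//.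
    by rewrite (lt_trans Nx)// (lt_trans delta_half)// invf_lt1// ltr1n.
  rewrite /kappa mulrAC ltr_pdivrMr// ltr_pM2l// (lt_le_trans x1)//.
  by rewrite lerDl.
Qed.

Lemma scaled_sup_is_norm (kappa : R) : 0 < kappa ->
  is_norm (fun x : V => kappa * `|x|).
Proof.
move=> k0; split => [x y|a x|x].
- by rewrite -mulrDr ler_pM2l// ler_normD.
- by rewrite normrZ mulrCA.
- by move=> /eqP; rewrite mulf_eq0 gt_eqF//= normr_eq0 => /eqP.
Qed.

Lemma le_norm_axis_matrix (x : V) : `|x| <= `|B2 *m x|.
Proof.
apply: norm_le_entries => // i j; rewrite ord1.
apply: le_trans (entry_le_norm _ i 0); rewrite B2E normrM ler_peMl//.
by apply: le_trans (ler_norm _); rewrite ltW.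
Qed.

Section Lower.
Variables (kappa delta2 : R).
Hypotheses (kappa0 : 0 < kappa) (d2 : 0 < delta2 < 2^-1)
  (d2lam : delta2 <= (lam - 1) / 2)
  (kdiam : kappa * cantor_diam lam (m := m) < 1)
  (mphi2 : mollifier (fun x => kappa * `|x|) delta2 phi).
Let N2 (x : V) := kappa * `|x|.
Let w2 := wseries B2 N2 phi.

Let annulus_axis (t : R) (y : V) : phi y != 0 ->
  1 <= kappa * `|t - y 0 0| < lam -> annulus B2 N2 (t *: e0 - y).
Proof.
move=> /(mollifier_support mphi2) y0 /andP[t1 tlam]; have /andP[_ d21] := d2.
have z0 : (t *: e0 - y) 0 0 = t - y 0 0 by rewrite !mxE eqxx mulr1.
split; last first.
  apply/negP; rewrite -leNgt (le_trans t1)// ler_pM2l// -z0; exact: entry_le_norm.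
exists (invmx B2 *m (t *: e0 - y)); last by rewrite mulKVmx.
rewrite /nball /= /N2 mulrC -ltr_pdivlMr// mul1r.
apply: norm_lt_entries => [|i j]; first by rewrite invr_gt0.
rewrite ord1; set z := t *: e0 - y in z0 *.
have zE : (invmx B2 *m z) i 0 = z i 0 / ratio 0 i.
  by rewrite -[in RHS](mulKVmx B2_unit z) B2E mulrC mulrA mulVf ?mul1r// gt_eqF// (lt_trans ltr01).
rewrite zE normrM normfV [`|ratio 0 i|]gtr0_norm ?(lt_trans ltr01)//.
rewrite ltr_pdivrMr ?(lt_trans ltr01)// mulrC ltr_pdivlMr// mulrC.
have [i0|i0] := eqVneq i 0; first by rewrite i0 z0 mxE eqxx.
apply: (@lt_trans _ _ 1); last exact: ratio1.
have -> : z i 0 = - y i 0 by rewrite !mxE (negPf i0) mulr0 add0r.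
rewrite normrN (le_lt_trans _ (lt_trans y0 (lt_trans d21 _)))//.
  by rewrite ler_pM2l// entry_le_norm.
by rewrite invf_lt1// ltr1n.
Qed.

Let half_space (s t : R) : (s = 1 \/ s = -1) ->
  (forall y : V, phi y != 0 -> s * y 0 0 <= 0 -> 1 <= kappa * `|t - y 0 0| < lam) ->
  2^-1 <= w2 (t *: e0).
Proof.
move=> s1 sP; have [_ phi_ge0 _ phiN phi1] := mphi2.
have /andP[_ d21] := d2.
apply: le_trans (convolution_le_wseries axis_matrix_expanding
  (scaled_sup_is_norm kappa0) d21 mphi2 _).
set g := fun y : V => (\1_(annulus B2 N2) (t *: e0 - y) * phi y)%:E.
have g0 (y : V) : (0 <= g y)%E by rewrite lee_fin mulr_ge0.
have gP (y : V) : s * y 0 0 <= 0 -> ((phi y)%:E <= g y)%E.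
  move=> sy; rewrite /g; have [->|py] := eqVneq (phi y) 0; first by rewrite mulr0.
  by rewrite indicE mem_set ?mul1r//; exact/annulus_axis/sP.
have half : ((2^-1)%:E <= integral_Rn g)%E.
  case: s1 => s1; rewrite {}s1 in gP.
    apply: (half_mass (f := fun x => (phi x)%:E)) => // [x|x x0].
    - by rewrite -phiN.
    - by apply: gP; rewrite mul1r.
  rewrite -integral_Rn_opp//.
  apply: (half_mass (f := fun x => (phi x)%:E)) => // [x|x x0].
  - by rewrite -phiN.
  - by rewrite [X in (X%:E <= _)%E]phiN; apply: gP; rewrite mxE mulN1r opprK.
have fin : integral_Rn g \is a fin_num.
  rewrite ge0_fin_numE ?integral_Rn_ge0//.
  by rewrite (le_lt_trans (convolution_le1 B2 mphi2 _))// ltry.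
by rewrite -lee_fin fineK.
Qed.

(** Half of the mass of [phi] keeps the point inside the annulus: the outer half
    when the point lies near the inner boundary, and the inner half when it lies
    near the outer boundary. *)
Let w2_fundamental_domain (t : R) :
  1 <= kappa * `|t| < lam -> 2^-1 <= w2 (t *: e0).
Proof.
move=> /andP[t1 tlam]; have /andP[d20 d21] := d2.
have small y : phi y != 0 -> kappa * `|y 0 0| < delta2.
  move=> /(mollifier_support mphi2); apply: le_lt_trans.
  by rewrite ler_pM2l// entry_le_norm.
have [s s1 tE] : exists2 s : R, s = 1 \/ s = -1 & `|t| = s * t.
  have [tge|tlt] := ger0P t; first by exists 1; [left|rewrite mul1r].
  by exists (-1); [right|rewrite mulN1r].
have normE (y : V) : `|t - y 0 0| = `| `|t| - s * y 0 0 |.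
  rewrite tE -mulrBr normrM; case: s1 => ->; rewrite ?normrN1 ?normr1 mul1r//.
have [inner|outer] := ltP (kappa * `|t|) (lam - delta2).
  apply: (half_space s1) => y /small ysmall ys; rewrite normE.
  have yE : `|y 0 0| = - (s * y 0 0).
    by rewrite -(ler0_norm ys) normrM; case: s1 => ->; rewrite ?normrN1 ?normr1 mul1r.
  rewrite yE in ysmall; rewrite ger0_norm ?addr_ge0 ?oppr_ge0//; apply/andP; split.
    by rewrite (le_trans t1)// ler_pM2l// lerDl oppr_ge0.
  by rewrite mulrBr; lra.
have s1' : - s = 1 \/ - s = -1 by case: s1 => ->; [right|left; rewrite opprK].
apply: (half_space s1') => y /small ysmall; rewrite mulNr oppr_le0 => ys.
have yE : `|y 0 0| = s * y 0 0.
  by rewrite -(ger0_norm ys) normrM; case: s1 => ->; rewrite ?normrN1 ?normr1 mul1r.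
rewrite normE -yE; have y0 : 0 <= kappa * `|y 0 0| by rewrite mulr_ge0// ltW.
have le_yt : 0 <= `|t| - `|y 0 0|.
  rewrite subr_ge0 -(ler_pM2l kappa0); apply: le_trans (ltW ysmall) _.
  by apply: le_trans t1; rewrite (le_trans (ltW d21))// invf_le1// ler1n.
have d2lam2 : delta2 + delta2 <= lam - 1.
  by move: d2lam; rewrite ler_pdivlMr// mulr_natr mulr2n.
rewrite ger0_norm// mulrBr; move: outer tlam ysmall y0 d2lam2.
move: (kappa * `|t|) (kappa * `|y 0 0|) lam delta2 => a a' l dl.
by move=> h1 h2 h3 h4 h5; apply/andP; split; lra.
Qed.

Let gauge2 : gauge B2 w2.
Proof.
apply: ultrametric_gauge axis_matrix_expanding _; exists N2, delta2, phi; split => //.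
  exact: scaled_sup_is_norm.
by move=> x; rewrite /N2 ler_pM2l// le_norm_axis_matrix.
Qed.

Let B2_pow_e0 (k : nat) (t : R) : B2 ^ k%:Z *m (t *: e0) = (lam ^+ k * t) *: e0.
Proof.
elim: k => [|k IH]; first by rewrite expr0z mul1mx expr0 mul1r.
rewrite -exprnP exprS -[B2 * _]/(B2 *m _) -mulmxA [X in _ *m X]IH B2e0.
by rewrite exprS mulrA.
Qed.

Let w2_pow (k : nat) (t : R) :
  w2 (t *: e0) = scale B2 k * w2 ((lam ^+ k * t) *: e0).
Proof.
have [_ _ wB _] := gauge2.
have sk := scale_gt0 axis_matrix_expanding k.
by rewrite -(B2_pow_e0 k t) wB (scaleN axis_matrix_expanding) mulVKf// gt_eqF.
Qed.

(** A power of the dilation moves the point into the fundamental domain, and the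
    number of steps is bounded because [|t| >= gap]. *)
Let w2_axis_lower : exists2 c : R, 0 < c & forall t,
  gap <= `|t| <= cantor_diam lam (m := m) -> c <= w2 (t *: e0).
Proof.
have eB2 := axis_matrix_expanding.
have [k1 k1P] : exists k1 : nat, 1 <= kappa * (lam ^+ k1 * gap).
  have kg0 : 0 < kappa * gap by rewrite mulr_gt0.
  have cv : lam^-1 ^+ k @[k --> \oo] --> 0.
    by apply: cvg_expr; rewrite ger0_norm ?invf_lt1// invr_ge0 ltW.
  have /cvgrPdist_lt /(_ _ kg0) [k _ /(_ k (leqnn k)) /=] := cv.
  rewrite sub0r normrN ger0_norm ?exprn_ge0 ?invr_ge0 ?(ltW lam0)// => h.
  exists k; rewrite mulrCA; move: h; rewrite exprVn => h.
  rewrite -(@mulfV _ (lam ^+ k)) ?gt_eqF ?exprn_gt0// ler_pM2l ?exprn_gt0//.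
  exact: ltW.
exists (scale B2 k1 / 2); first by rewrite divr_gt0// scale_gt0.
move=> t /andP[gt td].
have exk : exists k : nat, 1 <= kappa * (lam ^+ k * `|t|).
  exists k1; apply: le_trans k1P _; rewrite ler_pM2l// ler_pM2l// exprn_gt0//.
have [k kP kmin] := ex_minnP exk.
have kk1 : (k <= k1)%N.
  by apply: kmin; apply: le_trans k1P _; rewrite ler_pM2l// ler_pM2l// exprn_gt0.
have klam : kappa * (lam ^+ k * `|t|) < lam.
  case: k kP kmin {kk1} => [|k] kP kmin.
    rewrite expr0 mul1r (lt_trans _ lam1)// (le_lt_trans _ kdiam)//.
    by rewrite ler_pM2l.
  rewrite exprS -mulrA mulrCA gtr_pMr// ltNge; apply/negP => /kmin.
  by rewrite ltnn.
rewrite (w2_pow k); apply: ler_pM.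
- by rewrite ltW// scale_gt0.
- by rewrite invr_ge0.
- rewrite (scale_nat eB2 k) (scale_nat eB2 k1); apply: ler_wiXn2l => //.
    by rewrite ltW// scale_gt0.
  by rewrite ltW// scale1_lt1.
apply: w2_fundamental_domain; rewrite normrM ger0_norm ?exprn_ge0 ?(ltW lam0)//.
by rewrite kP klam.
Qed.

Lemma axis_cantor_coded : ultrametric B2 w2 /\ coded m (scale B2) w2 K2.
Proof.
have eB2 := axis_matrix_expanding.
split.
  exists N2, delta2, phi; split => //; first exact: scaled_sup_is_norm.
  by move=> x; rewrite /N2 ler_pM2l// le_norm_axis_matrix.
have [c c0 cP] := w2_axis_lower; have [_ _ _ wb] := gauge2.
have [C C0 CP] := wb (cantor_diam lam (m := m)).
have /choice[pi piP] : forall x : V, exists om, K2 x -> x = point om.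
  move=> x; have [[om _ <-]|nKx] := pselect (K2 x); first by exists om.
  by exists (fun=> Ordinal m0).
exists pi, c, C; split => // [om|x y Kx Ky xy].
  have Kom : K2 (point om) by exists om.
  by exists (point om) => //; exact/point_inj/esym/piP.
have /first_diff_exists[n fd] : pi x <> pi y.
  by move=> e; apply: xy; rewrite (piP _ Kx) (piP _ Ky) e.
exists n => //; have dist := cantor_distance m0 lamm fd.
pose t := cantor_point lam (pi x) - cantor_point lam (pi y).
have -> : x - y = t *: e0 by rewrite {1}(piP _ Kx) {1}(piP _ Ky) /point -scalerBl.
have t_dist : gap <= `|lam ^+ n * t| <= cantor_diam lam (m := m).
  rewrite normrM [`|lam ^+ n|]ger0_norm ?exprn_ge0 ?(ltW lam0)//.
  by rewrite [lam ^+ n * _]mulrC.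
rewrite (w2_pow n) [c * _]mulrC [C * _]mulrC !ler_pM2l ?scale_gt0//.
rewrite cP//=; apply: CP; rewrite normrZ (le_trans _ (proj2 (andP t_dist)))//.
by rewrite ler_piMr.
Qed.

End Lower.

Theorem dust_like_coded_set :
  exists (B2 : 'M[R]_d.+1) (w2 : V -> R) (D2 : 'I_m -> V) (K2 : set V),
    [/\ expanding B2, ultrametric B2 w2, self_affine_set B2 D2 K2,
        dust_like B2 D2 K2 & \det B2 = q /\ coded m (scale B2) w2 K2].
Proof.
have [kappa [delta2 [k0 d2 d2lam kdiam mphi2]]] := axis_gauge_constants.
have [um cod] := axis_cantor_coded k0 d2 d2lam kdiam mphi2.
exists axis_matrix, (wseries axis_matrix (fun x : V => kappa * `|x|) phi),
  axis_digit, axis_cantor; split => //.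
- exact: axis_matrix_expanding.
- exact: axis_cantor_self_affine.
- exact: axis_cantor_dust_like.
- by split => //; exact: det_axis_matrix.
Qed.

End DustLike.

Theorem theorem3p14 (R : realType) (d m : nat) (B : 'M[R]_d.+1)
    (w : 'cV[R]_d.+1 -> R)
    (D D' : 'I_m -> 'cV[R]_d.+1) (K K' J J' : set 'cV[R]_d.+1)
    (kappa kappa' : nat)
    (cls : set (seq 'I_m) -> 'I_kappa) (cls' : set (seq 'I_m) -> 'I_kappa')
    (A : 'M[nat]_kappa) (A' : 'M[nat]_kappa')
    (b : 'cV[nat]_kappa) (b' : 'cV[nat]_kappa') :
  expanding B -> ultrametric B w ->
  self_affine_set B D K -> self_affine_set B D' K' ->
  condition_Hw B D w K -> condition_Hw B D' w K' ->
  invariant_set B D J -> invariant_set B D' J' ->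
  class_enumeration B D J cls -> class_enumeration B D' J' cls' ->
  incidence_matrix B D J cls A -> incidence_matrix B D' J' cls' A' ->
  class_sizes B D J cls b -> class_sizes B D' J' cls' b' ->
  (rearrangeable m b A /\ rearrangeable m b' A') \/
  (primitive A /\ primitive A') ->
  lipschitz_equiv w K w K' /\
  exists (B2 : 'M[R]_d.+1) (w2 : 'cV[R]_d.+1 -> R)
      (D2 : 'I_m -> 'cV[R]_d.+1) (K2 : set 'cV[R]_d.+1),
    [/\ expanding B2, ultrametric B2 w2,
        self_affine_set B2 D2 K2, dust_like B2 D2 K2
      & lipschitz_equiv w K w2 K2 /\ lipschitz_equiv w K' w2 K2].
Proof.
move=> eB uw saK saK' HK HK' invJ invJ' clsP clsP' AP AP' bP bP' regular.
have gw := ultrametric_gauge eB uw; have [w_0 _ _ _] := gw.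
have codK : coded m (scale B) w K.
  apply: (ifs_coded eB saK invJ clsP AP bP gw HK).
  by case: regular => -[]; [left|right].
have codK' : coded m (scale B) w K'.
  apply: (ifs_coded eB saK' invJ' clsP' AP' bP' gw HK').
  by case: regular => -[]; [left|right].
have s_gt0 (n : nat) : 0 < scale B n by exact: scale_gt0.
split; first exact: (coded_lipschitz w_0 w_0 s_gt0 codK codK').
have m0 : (0 < m)%N by have [pi _] := codK; exact: leq_ltn_trans (ltn_ord (pi 0 0%N)).
have [_ cK _] := saK; have mq := coded_lt_det eB gw cK codK.
have [N [delta [phi [nN _ /andP[_ delta_half] mphi _]]]] := uw.
have [B2 [w2 [D2 [K2 [eB2 uw2 saK2 dK2 [detB2 codK2]]]]]] :=
  dust_like_coded_set nN delta_half mphi m0 mq.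
have [w2_0 _ _ _] := ultrametric_gauge eB2 uw2.
have scaleE : scale B2 = scale B.
  by apply/funext => k; rewrite /scale detB2 normr_id.
rewrite scaleE in codK2.
exists B2, w2, D2, K2; split => //.
by split; [exact: (coded_lipschitz w_0 w2_0 s_gt0 codK codK2)
  | exact: (coded_lipschitz w_0 w2_0 s_gt0 codK' codK2)].
Qed.
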